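(* For the Chaplygin sphere, let $\mu(\gamma)=Y(\gamma)^{1/2}$ with $Y(\gamma)=1-mr^2(\gamma\cdot A^{-1}\gamma)$, and define the bracket $\{\cdot,\cdot\tilde{\}}^{\mu}_{\mathcal{R}}$ of functions on $\mathcal{R}$ by $$\{F_1,F_2\tilde{\}}^{\mu}_{\mathcal{R}}:=\mu\,\{F_1,F_2\tilde{\}}_{\mathcal{R}},\qquad F_1,F_2\in C^\infty(\mathcal{R}),$$ where $\{\cdot,\cdot\tilde{\}}_{\mathcal{R}}$ is the reduced affine nonholonomic bracket. Then $\{\cdot,\cdot\tilde{\}}^{\mu}_{\mathcal{R}}$ satisfies the Jacobi identity.
   Context: Chaplygin sphere and its reduced affine bracket: an inhomogeneous sphere of mass $m>0$, radius $r>0$ and inertia tensor $\mathbb{I}=\mathrm{diag}(I_1,I_2,I_3)$, $I_i>0$, rolls without slipping on a plane. Its configuration space is $Q=SO(3)\times\mathbb{R}^2\ni(g;(x,y))$, with Lagrangian $\mathcal{L}=\frac12(\mathbb{I}\omega^b)\cdot\omega^b+\frac12m(v_x^2+v_y^2)$ and constraints $v_x=r\omega^s_2$, $v_y=-r\omega^s_1$, where $\hat\omega^b=g^{-1}\dot g$, $\omega^s=g\omega^b$ (hat map $\hat{\mathbf v}\mathbf w=\mathbf v\times\mathbf w$). $\mathcal{M}\subset T^*Q$ is the image of the constraint distribution under the Legendre transform, and $\mathcal{C}\subset T\mathcal{M}$ is the distribution of vectors whose projection to $TQ$ satisfies the constraints. Let $\tilde\Omega_Q=\Omega_Q-mr^2\,\mathbf{i}_{X_{\mathcal{H}}}\bar\nu$,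 with $\Omega_Q=dq_a\wedge dp_a$ the canonical symplectic form, $X_{\mathcal{H}}$ the Hamiltonian vector field ($\mathbf{i}_{X_{\mathcal{H}}}\Omega_Q=d\mathcal{H}$) of the kinetic energy $\mathcal{H}$ on $T^*Q$, and $\bar\nu$ the pull-back to $T^*Q$ of the bi-invariant volume form $\nu$ on $SO(3)$ normalized by $\nu(e_1,e_2,e_3)=1$. With $\tilde{\mathcal{P}}$ the projector onto $\mathcal{C}$ along its $\tilde\Omega_Q$-orthogonal complement, the affine nonholonomic bracket on $\mathcal{M}$ is $\{f_1,f_2\tilde{\}}_{\mathcal{M}}=\tilde\Omega_Q(\tilde{\mathcal{P}}\tilde X_{\bar f_1},\tilde{\mathcal{P}}\tilde X_{\bar f_2})$, where $\bar f_i$ are arbitrary extensions of $f_i$ to $T^*Q$ and $\mathbf{i}_{\tilde X_{\bar f}}\tilde\Omega_Q=d\bar f$. It is invariant under the cotangent lift of the $SE(2)$ action $(h;a,b):(g;(x,y))\mapsto(hg;(x,y)\tilde h^t+(a,b))$, with $h=\begin{pmatrix}\tilde h&0\\0&1\end{pmatrix}$, $\tilde h\in SO(2)$, and it induces $\{\cdot,\cdot\tilde{\}}_{\mathcal{R}}$ on $\mathcal{R}=\mathcal{M}/SE(2)$ by $\{F_1,F_2\tilde{\}}_{\mathcal{R}}\circ\pi=\{F_1\circ\pi,F_2\circ\pi\tilde{\}}_{\mathcal{M}}$, $\pi$ the orbit projection. Explicit description: $\mathcal{R}$ is identified with $\{(\mathbf K^b,\gamma)\in\mathbb{R}^3\times\mathbb{R}^3:\|\gamma\|=1\}\cong\mathbb{R}^3\times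 S^2$, where $\gamma=g^{-1}e_3$ and $\mathbf K^b=\mathbb{I}\omega^b+mr^2(\omega^b-(\omega^b\cdot\gamma)\gamma)$ is the angular momentum about the contact point in body coordinates, and the bracket $\{\cdot,\cdot\tilde{\}}_{\mathcal{R}}$ is the (bilinear, skew-symmetric, Leibniz) bracket determined by $$\{K^b_i,K^b_j\tilde{\}}_{\mathcal{R}}=-c_{ijl}\bigl(K^b_l-mr^2\omega^s_3\gamma_l\bigr),\quad\{K^b_i,\gamma_j\tilde{\}}_{\mathcal{R}}=-c_{ijl}\gamma_l,\quad\{\gamma_i,\gamma_j\tilde{\}}_{\mathcal{R}}=0,$$ where $c_{ijl}$ is the Levi-Civita symbol and $\omega^s_3=\frac{\mathbf K^b\cdot A^{-1}\gamma}{Y(\gamma)}$ with $A=\mathbb{I}+mr^2E$ ($E$ the $3\times3$ identity matrix) and $Y(\gamma)=1-mr^2(\gamma\cdot A^{-1}\gamma)$, which is strictly positive when $\|\gamma\|=1$. ($\|\gamma\|^2$ is a Casimir, so these formulas define a bracket on $\mathcal{R}$.) *)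

(* Defs.v *)
From HB Require Import structures.
From mathcomp Require Import all_boot all_order all_algebra.
From mathcomp Require Import all_classical all_reals all_analysis.
Set Implicit Arguments. Unset Strict Implicit. Unset Printing Implicit Defensive.
Import Order.TTheory GRing.Theory Num.Theory numFieldNormedType.Exports.
Local Open Scope classical_set_scope.
Local Open Scope ring_scope.

Definition dot (R : realType) (n : nat) (u v : 'cV[R]_n) : R :=
  \sum_i u i 0 * v i 0.

(* Indices in 'I_3 are added modulo 3. *)
Definition cross (R : realType) (u v : 'cV[R]_3) : 'cV[R]_3 :=
  \col_(i < 3) (u (i + 1) 0 * v (i + 2%:R) 0 - u (i + 2%:R) 0 * v (i + 1) 0).

Definition hat (R : realType) (v : 'cV[R]_3) : 'M[R]_3 :=
  \matrix_(i, j) cross v (delta_mx j 0) i 0.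

Definition e3 (R : realType) : 'cV[R]_3 := delta_mx 2%:R 0.

Definition SO3 (R : realType) : set 'M[R]_3 :=
  [set g | g^T *m g = 1%:M /\ \det g = 1].
Arguments SO3 {R}.

(* C^n on an open set U; the derivatives are taken in arbitrary constant
   directions. *)
Fixpoint Cn_on (R : realType) (V : normedModType R) (U : set V) (n : nat)
    (f : V -> R) : Prop :=
  match n with
  | 0%N => forall x, U x -> {for x, continuous f}
  | k.+1 => (forall x, U x -> differentiable f x) /\
            forall v : V, Cn_on U k (fun x => 'D_v f x)
  end.

(* F is C^oo on the embedded submanifold S: locally it is the restriction of a
   C^oo function of the ambient space. Values of F outside S are irrelevant. *)
Definition smooth_on (R : realType) (V : normedModType R) (S : set V)
    (F : V -> R) : Prop :=
  forall z, S z -> exists U : set V, exists G : V -> R,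
    [/\ open U, U z, (forall n, Cn_on U n G) &
        forall w, U w -> S w -> G w = F w].

(* T^*Q for Q = SO(3) x R^2, left-trivialized: (g, q, M, p) with g in SO(3)
   stands for the covector (g hat(w), v) |-> M . w + p . v at (g, q).  [phase R]
   is the ambient vector space, without the condition on g. *)
Notation phase R :=
  ('M[R]_3 * 'cV[R]_2 * 'cV[R]_3 * 'cV[R]_2)%type.
Notation rot x := (x.1.1.1) (only parsing).
Notation bmom x := (x.1.2) (only parsing).
Notation pmom x := (x.2) (only parsing).

(* A tangent vector to T^*Q at (g, q, M, p) is (w, v, M', p'), where the
   velocity of g is g hat(w). *)
Notation tangent R :=
  ('cV[R]_3 * 'cV[R]_2 * 'cV[R]_3 * 'cV[R]_2)%type.
Notation tw X := (X.1.1.1) (only parsing).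
Notation tv X := (X.1.1.2) (only parsing).
Notation tM X := (X.1.2) (only parsing).
Notation tp X := (X.2) (only parsing).

Definition ambient (R : realType) (x : phase R) (X : tangent R) : phase R :=
  (rot x *m hat (tw X), tv X, tM X, tp X).

Definition dphase (R : realType) (f : phase R -> R) (x : phase R)
    (X : tangent R) : R := 'd f x (ambient x X).

(* The canonical form dq_a /\ dp_a = - d theta, theta = M . w + p . v; the term
   M . (X_w x Y_w) comes from the Maurer-Cartan equation
   dw (X, Y) = - X_w x Y_w of the left-invariant forms. *)
Definition OmegaQ (R : realType) (x : phase R) (X Y : tangent R) : R :=
  dot (tw X) (tM Y) - dot (tw Y) (tM X) + dot (bmom x) (cross (tw X) (tw Y))
  + dot (tv X) (tp Y) - dot (tv Y) (tp X).

(* The vector X such that i_X Om = alpha. *)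
Definition sharp (R : realType) (Om : tangent R -> tangent R -> R)
    (alpha : tangent R -> R) : tangent R :=
  get [set X | forall Y, Om X Y = alpha Y].

(* The projector onto the subspace C along its Om-orthogonal complement. *)
Definition oproj (R : realType) (Om : tangent R -> tangent R -> R)
    (C : set (tangent R)) (X : tangent R) : tangent R :=
  get [set Z | C Z /\ forall W, C W -> Om (X - Z) W = 0].

Section ChaplyginSphere.
Variables (R : realType) (mass r : R) (J : 'rV[R]_3).

Definition inertia : 'M[R]_3 := diag_mx J.

(* (w, v) are the body angular velocity and the velocity of (x, y) at an
   attitude g; the space angular velocity is g w. *)
Definition rolling (g : 'M[R]_3) (w : 'cV[R]_3) (v : 'cV[R]_2) : Prop :=
  v 0 0 = r * (g *m w) 1 0 /\ v 1 0 = - r * (g *m w) 0 0.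

Definition Mset : set (phase R) :=
  [set x | SO3 (rot x) /\ exists w v, [/\ rolling (rot x) w v,
     bmom x = inertia *m w & pmom x = mass *: v]].

Definition TMset (x : phase R) : set (tangent R) :=
  [set X | exists c : R -> phase R, [/\ c 0 = x, (\forall t \near 0, Mset (c t))
     & is_derive (0 : R) (1 : R) c (ambient x X)]].

Definition Cdist (x : phase R) : set (tangent R) :=
  [set X | TMset x X /\ rolling (rot x) (tw X) (tv X)].

Definition hamiltonian (x : phase R) : R :=
  2^-1 * dot (bmom x) (invmx inertia *m bmom x)
  + (2 * mass)^-1 * dot (pmom x) (pmom x).

Definition XH (x : phase R) : tangent R :=
  sharp (OmegaQ x) (dphase hamiltonian x).

(* The pull-back to T^*Q of the bi-invariant volume form on SO(3). *)
Definition nu (X Y Z : tangent R) : R := dot (tw X) (cross (tw Y) (tw Z)).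

Definition OmegaT (x : phase R) (X Y : tangent R) : R :=
  OmegaQ x X Y - mass * r ^+ 2 * nu (XH x) X Y.

(* An extension of f from Mset, differentiable at x. *)
Definition extension (f : phase R -> R) (x : phase R) : phase R -> R :=
  get [set h : phase R -> R | differentiable h x /\
                              forall y, Mset y -> h y = f y].

(* The affine nonholonomic bracket at a point x of Mset; it does not depend on
   the extensions, of which an arbitrary one is chosen. *)
Definition bracketM (f1 f2 : phase R -> R) (x : phase R) : R :=
  let PX f := oproj (OmegaT x) (Cdist x)
                    (sharp (OmegaT x) (dphase (extension f x) x)) in
  OmegaT x (PX f1) (PX f2).

(* The reduced space Mset / SE(2), as the set of the pairs (K, gamma). *)
Definition Rset : set ('cV[R]_3 * 'cV[R]_3) := [set z | dot z.2 z.2 = 1].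

Definition gamma (x : phase R) : 'cV[R]_3 := invmx (rot x) *m e3 R.

Definition Kb (x : phase R) : 'cV[R]_3 :=
  let w := invmx inertia *m bmom x in
  inertia *m w + (mass * r ^+ 2) *: (w - dot w (gamma x) *: gamma x).

(* The orbit projection. *)
Definition pi_red (x : phase R) : 'cV[R]_3 * 'cV[R]_3 := (Kb x, gamma x).

(* The bracket induced on the reduced space; its values outside Rset are
   irrelevant. *)
Definition bracketR (F1 F2 : 'cV[R]_3 * 'cV[R]_3 -> R) :
    'cV[R]_3 * 'cV[R]_3 -> R :=
  get [set G : 'cV[R]_3 * 'cV[R]_3 -> R | forall x, Mset x ->
    G (pi_red x) = bracketM (F1 \o pi_red) (F2 \o pi_red) x].

Definition Amx : 'M[R]_3 := inertia + (mass * r ^+ 2)%:M.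

Definition Yfun (c : 'cV[R]_3) : R :=
  1 - mass * r ^+ 2 * dot c (invmx Amx *m c).

Definition mu (c : 'cV[R]_3) : R := Num.sqrt (Yfun c).

Definition bracketRmu (F1 F2 : 'cV[R]_3 * 'cV[R]_3 -> R)
    (z : 'cV[R]_3 * 'cV[R]_3) : R :=
  mu z.2 * bracketR F1 F2 z.

End ChaplyginSphere.

(* Main.v *)
From HB Require Import structures.
From mathcomp Require Import all_boot all_order all_algebra.
From mathcomp Require Import all_classical all_reals all_analysis.
From mathcomp Require Import ring lra.
Require Import Defs.
Import Order.TTheory GRing.Theory Num.Theory numFieldNormedType.Exports.
Local Open Scope classical_set_scope.
Local Open Scope ring_scope.
Set Implicit Arguments. Unset Strict Implicit. Unset Printing Implicit Defensive.

(** Write k = mass r^2, A = I + k and n = A^-1 gamma.  The proof has two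
    halves.

    Mechanics.  A vector of the constraint distribution is determined by its
    angular velocity u and by the velocity K' that it gives to the contact
    momentum K; gamma then moves with velocity gamma x u.  In the coordinates
    (u, K') the canonical form minus the volume term becomes
    [u1 . K2' - u2 . K1' + L . (u1 x u2)] with L = K - k (w . gamma) gamma, w
    the angular velocity of the state: all the dependence on the state is in
    the vector L ([OmegaT_constrained]).  This form is nondegenerate and its
    inverse can be read off, so the vector field attached to a function with
    gradient (a, b) in (K, gamma) is u = a, K' = L x a + gamma x b
    ([oproj_sharpP]), and the bracket is
    [- (L . (a1 x a2) + gamma . (a1 x b2 - a2 x b1))] ([bracketM_eq]).  The
    spin w . gamma is K . n / Y, a function of (K, gamma); as the projection
    to (K, gamma) is onto, the formula is that of the reduced bracket too
    ([bracketR_eq]).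

    Poisson geometry.  Near each point of the reduced space the bracket times
    mu is therefore the bracket [gradbr] of functions on an open set of R^6,
    and {G, H} is the derivative of H along the vector [hamvec G].  In the
    cyclic sum of {G1, {G2, G3}} the second derivatives cancel, because they
    are symmetric ([derive_comm]).  What is left is trilinear in the
    gradients ([dgradbr_cyclic]).  Without k it is the Jacobi identity of the
    Lie-Poisson bracket of e(3).  The terms with k come from the derivative
    of gamma in L, and cancel by the Jacobi identity of so(3), and from the
    derivatives of the spin and of the density mu, which the choice mu^2 = Y
    makes opposite ([cyclic_density]). *)

(** * Vectors in three dimensions *)

Lemma ord3P (P : 'I_3 -> Prop) : P 0 -> P 1 -> P 2%:R -> forall i, P i.
Proof.
move=> P0 P1 P2 [[|[|[|//]]] lt]; [move: P0|move: P1|move: P2];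
  by congr P; apply: val_inj.
Qed.

Section VectorAlgebra.
Variable R : realType.

Lemma dotDr n (u v w : 'cV[R]_n) : dot u (v + w) = dot u v + dot u w.
Proof. by rewrite -big_split; apply: eq_bigr => i _; rewrite mxE mulrDr. Qed.
Lemma dotZr n (a : R) (u v : 'cV[R]_n) : dot u (a *: v) = a * dot u v.
Proof. by rewrite /dot mulr_sumr; apply: eq_bigr => i _; rewrite mxE mulrCA. Qed.
Lemma dotC n (u v : 'cV[R]_n) : dot u v = dot v u.
Proof. by apply: eq_bigr => i _; rewrite mulrC. Qed.

Implicit Types u v w : 'cV[R]_3.

Lemma sum3E (F : 'I_3 -> R) : \sum_i F i = F 0 + F 1 + F 2%:R.
Proof.
rewrite !big_ord_recl big_ord0 addr0 addrA.
by congr (F _ + F _ + F _); apply: val_inj.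
Qed.

Lemma dotE u v : dot u v = u 0 0 * v 0 0 + u 1 0 * v 1 0 + u 2%:R 0 * v 2%:R 0.
Proof. exact: sum3E. Qed.

Lemma crossE u v :
  (cross u v 0 0 = u 1 0 * v 2%:R 0 - u 2%:R 0 * v 1 0) *
  (cross u v 1 0 = u 2%:R 0 * v 0 0 - u 0 0 * v 2%:R 0) *
  (cross u v 2%:R 0 = u 0 0 * v 1 0 - u 1 0 * v 0 0).
Proof.
have [e1 e2] : (1 + 1 : 'I_3) = 2%:R /\ (1 + 2%:R : 'I_3) = 0 by split; apply: val_inj.
have [e3 e4] : (2%:R + 1 : 'I_3) = 0 /\ (2%:R + 2%:R : 'I_3) = 1 by split; apply: val_inj.
by rewrite /cross !mxE !add0r e1 e2 e3 e4.
Qed.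

Lemma colE : (forall u v i, (u + v) i 0 = u i 0 + v i 0) *
  (forall u i, (- u) i 0 = - u i 0) *
  (forall (c : R) u i, (c *: u) i 0 = c * u i 0) *
  (forall i, (0 : 'cV[R]_3) i 0 = 0).
Proof. by do !split=> *; rewrite mxE. Qed.

Lemma col3P u v : u 0 0 = v 0 0 -> u 1 0 = v 1 0 -> u 2%:R 0 = v 2%:R 0 -> u = v.
Proof.
by move=> e0 e1 e2; apply/matrixP => i j; rewrite ord1; elim/ord3P: i.
Qed.

Lemma dot_inj u v : (forall t : 'cV[R]_3, dot u t = dot v t) -> u = v.
Proof.
by move=> uv; apply: col3P;
  [have := uv (delta_mx 0 0)|have := uv (delta_mx 1 0)|have := uv (delta_mx 2%:R 0)];
  rewrite !dotE !mxE /= !(mulr0, mulr1, addr0, add0r).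
Qed.

Lemma mulmx3E (A : 'M[R]_3) u i :
  (A *m u) i 0 = A i 0 * u 0 0 + A i 1 * u 1 0 + A i 2%:R * u 2%:R 0.
Proof. by rewrite mxE sum3E. Qed.

End VectorAlgebra.

Definition vecE := (dotE, crossE, colE).

(** * Differential calculus *)

Section Calculus.
Variables (R : realType) (V : normedModType R).
Implicit Types (x : V).

Lemma is_diff_dfE (W : normedModType R) x (f df df' : V -> W) :
  is_diff x f df -> df =1 df' -> is_diff x f df'.
Proof. by move=> H /funext <-. Qed.

Lemma is_diff_near (W : normedModType R) x (f g df : V -> W) :
  is_diff x f df -> (\near x, f x = g x) -> is_diff x g df.
Proof.
move=> [Hf Ef] Hg.
have Hgx : f x = g x by exact: nbhs_singleton Hg.
have [fc fE] := (diff_locallyP _ _).1 Hf.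
have gE : g \o shift x = cst (g x) + 'd f x +o_ 0 id.
  apply/eqaddoP => e e0; move/eqaddoP : fE => /(_ e e0) fE.
  have Hg0 : \forall h \near 0, f (h + x) = g (h + x).
    by move: Hg; rewrite [X in X -> _](near_shift 0) subr0.
  near=> h.
  have -> : (g \o shift x - (cst (g x) + 'd f x)) h
          = (f \o shift x - (cst (f x) + 'd f x)) h.
    rewrite Hgx; congr (_ - _).
    by apply/esym; near: h.
  by near: h; exact: fE.
have dgE : 'd g x = 'd f x :> (V -> W) by exact: diff_unique.
by apply: DiffDef; [apply/diff_locallyP; rewrite dgE|rewrite dgE].
Unshelve. all: by end_near. Qed.

(** The differentiation rules are restated for functions given by their values,
    with the differential applied to a vector: the goals that follow are
    expressions in a point, to which the pointwise-operator forms do not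
    unify. *)
Lemma is_diff_addf (W : normedModType R) x (f g df dg : V -> W) :
  is_diff x f df -> is_diff x g dg ->
  is_diff x (fun y => f y + g y) (fun v => df v + dg v).
Proof. exact: is_diffD. Qed.

Lemma is_diff_oppf (W : normedModType R) x (f df : V -> W) :
  is_diff x f df -> is_diff x (fun y => - f y) (fun v => - df v).
Proof. exact: is_diffN. Qed.

Lemma is_diff_subf (W : normedModType R) x (f g df dg : V -> W) :
  is_diff x f df -> is_diff x g dg ->
  is_diff x (fun y => f y - g y) (fun v => df v - dg v).
Proof. exact: is_diffB. Qed.

Lemma is_diff_mulf x (f g df dg : V -> R) :
  is_diff x f df -> is_diff x g dg ->
  is_diff x (fun y => f y * g y) (fun v => df v * g x + f x * dg v).
Proof.
move=> H1 H2; apply: is_diff_dfE (is_diffM H1 H2) _ => v.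
by rewrite addrC mulrC.
Qed.

Lemma is_diff_cstf (W : normedModType R) x (a : W) : is_diff x (fun=> a) (fun=> 0).
Proof. exact: is_diff_cst. Qed.

Lemma is_diff_sumf (W : normedModType R) x n (f df : 'I_n -> V -> W) :
  (forall i, is_diff x (f i) (df i)) ->
  is_diff x (fun y => \sum_i f i y) (fun v => \sum_i df i v).
Proof.
elim: n f df => [|n IH] f df H.
  under eq_fun do rewrite big_ord0.
  by apply: is_diff_dfE (is_diff_cstf _ _) _ => v; rewrite big_ord0.
under eq_fun do rewrite big_ord_recl.
by apply: is_diff_dfE (is_diff_addf (H _) (IH _ _ (fun i => H _))) _ => v;
  rewrite big_ord_recl.
Qed.

Lemma is_diff_scalef (W : normedModType R) x (c dc : V -> R) (a : W) :
  is_diff x c dc -> is_diff x (fun y => c y *: a) (fun v => dc v *: a).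
Proof.
by move=> H; apply: DiffDef; [exact: differentiableZl|rewrite diffZl// diff_val].
Qed.

(** A matrix is the sum of its entries times constant matrices, which reduces
    matrix-valued functions to scalar ones. *)
Lemma is_diff_mx x m n (f df : V -> 'M[R]_(m, n)) :
  (forall i j, is_diff x (fun y => f y i j) (fun v => df v i j)) ->
  is_diff x f df.
Proof.
move=> H.
have -> : f = fun y => \sum_i \sum_j f y i j *: delta_mx i j.
  by apply/funext => y; rewrite -matrix_sum_delta.
apply: is_diff_dfE; first do 2![apply: is_diff_sumf => ?].
  exact: is_diff_scalef.
by move=> v /=; rewrite -matrix_sum_delta.
Qed.

Lemma is_diff_coord x m n (f df : V -> 'M[R]_(m, n)) i j :
  is_diff x f df -> is_diff x (fun y => f y i j) (fun v => df v i j).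
Proof.
move=> H.
pose c := fun M : 'M[R]_(m, n) => M i j.
have lc : linear c by move=> a u v; rewrite /c !mxE.
pose cM := GRing.isLinear.Build _ _ _ _ _ lc.
pose cL : {linear _ -> _} := HB.pack c cM.
have hc M : is_diff M cL cL.
  have cc : continuous cL by exact: coord_continuous.
  by apply: DiffDef; [exact: linear_differentiable|exact: diff_lin].
exact: (is_diff_comp H (hc _)).
Qed.

Lemma is_diff_fstf (W1 W2 : normedModType R) x (f df : V -> W1 * W2) :
  is_diff x f df -> is_diff x (fun y => (f y).1) (fun v => (df v).1).
Proof.
move=> H; have hc p : is_diff p (@fst W1 W2) fst.
  have cc : continuous (@fst W1 W2) by move=> ?; exact: cvg_fst.
  by apply: DiffDef; [exact: linear_differentiable|exact: diff_lin].
exact: (is_diff_comp H (hc _)).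
Qed.

Lemma is_diff_sndf (W1 W2 : normedModType R) x (f df : V -> W1 * W2) :
  is_diff x f df -> is_diff x (fun y => (f y).2) (fun v => (df v).2).
Proof.
move=> H; have hc p : is_diff p (@snd W1 W2) snd.
  have cc : continuous (@snd W1 W2) by move=> ?; exact: cvg_snd.
  by apply: DiffDef; [exact: linear_differentiable|exact: diff_lin].
exact: (is_diff_comp H (hc _)).
Qed.

Lemma is_diff_dot x n (f g df dg : V -> 'cV[R]_n) :
  is_diff x f df -> is_diff x g dg ->
  is_diff x (fun y => dot (f y) (g y)) (fun v => dot (df v) (g x) + dot (f x) (dg v)).
Proof.
move=> H1 H2; apply: is_diff_dfE; first apply: is_diff_sumf => i.
  by apply: is_diff_mulf; exact: is_diff_coord.
by move=> v; rewrite big_split.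
Qed.

Lemma is_diff_mulmx x m n p (f df : V -> 'M[R]_(m, n)) (g dg : V -> 'M[R]_(n, p)) :
  is_diff x f df -> is_diff x g dg ->
  is_diff x (fun y => f y *m g y) (fun v => df v *m g x + f x *m dg v).
Proof.
move=> H1 H2; apply: is_diff_mx => i j; under eq_fun do rewrite mxE.
apply: is_diff_dfE; first apply: is_diff_sumf => k.
  by apply: is_diff_mulf; exact: is_diff_coord.
by move=> v; rewrite !mxE -big_split.
Qed.

Lemma is_diff_mulmxr x m n p (a : 'M[R]_(m, n)) (g dg : V -> 'M[R]_(n, p)) :
  is_diff x g dg -> is_diff x (fun y => a *m g y) (fun v => a *m dg v).
Proof.
move=> H; apply: is_diff_dfE (is_diff_mulmx (is_diff_cstf _ a) H) _ => v.
by rewrite mul0mx add0r.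
Qed.

Lemma is_diff_trmx x m n (f df : V -> 'M[R]_(m, n)) :
  is_diff x f df -> is_diff x (fun y => (f y)^T) (fun v => (df v)^T).
Proof.
move=> H; apply: is_diff_mx => i j.
rewrite (_ : (fun y => _) = fun y => f y j i); last by apply/funext => y; rewrite mxE.
by apply: is_diff_dfE (is_diff_coord _ _ H) _ => v; rewrite mxE.
Qed.

Lemma is_diff_scale x m n (c dc : V -> R) (f df : V -> 'M[R]_(m, n)) :
  is_diff x c dc -> is_diff x f df ->
  is_diff x (fun y => c y *: f y) (fun v => dc v *: f x + c x *: df v).
Proof.
move=> H1 H2; apply: is_diff_mx => i j.
rewrite (_ : (fun y => _) = fun y => c y * f y i j); last first.
  by apply/funext => y; rewrite mxE.
by apply: is_diff_dfE (is_diff_mulf H1 (is_diff_coord i j H2)) _ => v; rewrite !mxE.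
Qed.

Lemma is_diff_cross x (f g df dg : V -> 'cV[R]_3) :
  is_diff x f df -> is_diff x g dg ->
  is_diff x (fun y => cross (f y) (g y))
            (fun v => cross (df v) (g x) + cross (f x) (dg v)).
Proof.
move=> H1 H2; apply: is_diff_mx => i j.
rewrite (_ : (fun y => _) = fun y => f y (i + 1) 0 * g y (i + 2%:R) 0
    - f y (i + 2%:R) 0 * g y (i + 1) 0); last by apply/funext => y; rewrite mxE.
have Hf k := is_diff_coord k 0 H1; have Hg k := is_diff_coord k 0 H2.
apply: is_diff_dfE (is_diff_subf (is_diff_mulf (Hf _) (Hg _))
  (is_diff_mulf (Hf _) (Hg _))) _.
by move=> v; rewrite !mxE; ring.
Qed.

End Calculus.

Lemma is_diff_derive (R : realType) (V W : normedModType R) (f df : V -> W) x v :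
  is_diff x f df -> 'D_v f x = df v.
Proof. by move=> [D E]; rewrite deriveE// E. Qed.

Section Symmetry.
Variables (R : realType) (V : normedModType R).
Implicit Types (x : V).

Lemma is_diff_invf x (f df : V -> R) : f x != 0 -> is_diff x f df ->
  is_diff x (fun y => (f y)^-1) (fun v => - (f x) ^- 2 * df v).
Proof.
move=> fx0 H; apply: DiffDef; first exact: differentiableV.
by rewrite diffV// diff_val.
Qed.

Lemma is_diff_sqrtf x (f df : V -> R) : 0 < f x -> is_diff x f df ->
  is_diff x (fun y => Num.sqrt (f y)) (fun v => (2 * Num.sqrt (f x))^-1 * df v).
Proof.
move=> fx0 H; have [Ds Es] := is_derive1_sqrt fx0.
have ds : is_diff (f x) Num.sqrt (fun h : R => (2 * Num.sqrt (f x))^-1 * h).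
  apply: DiffDef; first exact/derivable1_diffP.
  rewrite deriv1E// derive1E Es; by apply/funext => h; rewrite [LHS]mulrC.
exact: (is_diff_comp H ds).
Qed.

Lemma is_derive_line (W : normedModType R) (f : V -> W) x v (t : R) :
  differentiable f (x + t *: v) ->
  is_derive t (1 : R) (fun s => f (x + s *: v)) ('D_v f (x + t *: v)).
Proof.
move=> Df.
have H : is_diff t (fun s : R => x + s *: v) (fun s : R => s *: v).
  apply: is_diff_dfE (is_diff_addf (is_diff_cstf _ x)
    (is_diff_scalef v (is_diff_id t))) _ => s /=.
  by rewrite add0r.
have HD := is_diff_comp H (differentiableP Df).
apply: DeriveDef; first exact/diff_derivable/ex_diff.
by rewrite (is_diff_derive (1 : R) HD) /= scale1r deriveE.
Qed.

(** The explicit radius lets two expansions be used at vectors that depend on an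
    intermediate point given by the mean value theorem. *)
Lemma differentiable_expansion (f : V -> R) x (e : R) :
  differentiable f x -> 0 < e ->
  exists2 d : R, 0 < d & forall h, `|h| < d ->
    `|f (x + h) - f x - 'd f x h| <= e * `|h|.
Proof.
move=> /diff_locallyP[_] /eqaddoP /(_ e) H /H /nbhs_normP[d /= d0 {}H].
exists d => // h hd.
have /= := H h; rewrite distrC subr0 hd opprD addrA (addrC x); exact.
Qed.

(** The second difference is [g h - g 0] for the increment g of f along h v.  By
    the mean value theorem it is h times an increment of [D_u f] along h v, and
    the differential of [D_u f] at x gives the main term; u and v enter the
    left-hand side symmetrically except for [D_v (D_u f)]. *)
Lemma second_difference (f : V -> R) x u v (e : R) :
  (\near x, differentiable f x) -> differentiable ('D_u f) x -> 0 < e ->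
  exists2 d : R, 0 < d & forall h, 0 < h -> h < d ->
    `|f (x + h *: v + h *: u) - f (x + h *: u) - f (x + h *: v) + f x
      - h ^+ 2 * 'D_v ('D_u f) x| <= e * h ^+ 2.
Proof.
move=> /nbhs_normP[d1 /= d10 Df] Du e0.
(* N bounds the sum of the lengths of the two vectors c u + h v and c u, both
   divided by h, at which D_u f is expanded. *)
set N := 2 * `|u| + `|v| + 1.
have N0 : 0 < N by rewrite /N ltr_wpDl// addr_ge0// mulr_ge0.
have eN : 0 < e / N by exact: divr_gt0.
have [d2 d20 Hd2] := differentiable_expansion Du eN.
exists (Num.min d1 d2 / N); first by rewrite divr_gt0// lt_min d10.
move=> h h0; rewrite ltr_pdivlMr// lt_min => /andP[hd1 hd2].
have small (s t : R) : 0 <= s <= h -> 0 <= t <= h -> `|t *: v + s *: u| <= h * N - h - h * `|u|.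
  move=> /andP[s0 sh] /andP[t0 th]; rewrite (le_trans (ler_normD _ _))// !normrZ !ger0_norm//.
  have := ler_wpM2r (normr_ge0 u) sh; have := ler_wpM2r (normr_ge0 v) th; rewrite /N; lra.
have small0 (s t : R) : 0 <= s <= h -> 0 <= t <= h -> `|t *: v + s *: u| < h * N.
  move=> s1 t1; apply: le_lt_trans (small s t s1 t1) _.
  have : 0 <= h * `|u| by rewrite mulr_ge0// ltW.
  lra.
have D s t : 0 <= s <= h -> 0 <= t <= h -> differentiable f (x + t *: v + s *: u).
  move=> s1 t1; apply: Df; rewrite /ball_ /= -addrA opprD addNKr normrN.
  exact: lt_trans (small0 _ _ s1 t1) hd1.
have hh : 0 <= h <= h by rewrite lexx ltW.
have z0 : 0 <= (0 : R) <= h by rewrite lexx ltW.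
pose g s := f (x + h *: v + s *: u) - f (x + s *: u).
pose dg s := 'D_u f (x + h *: v + s *: u) - 'D_u f (x + s *: u).
have Dg s : 0 <= s <= h -> is_derive s (1 : R) g (dg s).
  move=> s1; apply: is_deriveB; apply: is_derive_line; first exact: D.
  by have := D s 0 s1 z0; rewrite scale0r addr0.
have [c] : exists2 c, c \in `]0, h[%R & g h - g 0 = dg c * (h - 0).
  apply: MVT => // [s|].
    by rewrite in_itv /= => /andP[/ltW s0 /ltW s1]; apply: Dg; rewrite s0.
  apply: derivable_within_continuous => s; rewrite in_itv /= => s1.
  by have [] := Dg s s1.
rewrite in_itv /= subr0 => /andP[/ltW c0 /ltW ch] gE.
have c1 : 0 <= c <= h by rewrite c0.
have -> : f (x + h *: v + h *: u) - f (x + h *: u) - f (x + h *: v) + f x = g h - g 0.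
  by rewrite /g !scale0r !addr0; ring.
have E1 := Hd2 _ (lt_trans (small0 _ _ c1 hh) hd2).
have E2 := Hd2 _ (lt_trans (small0 _ _ c1 z0) hd2).
have S1 := small _ _ c1 hh; have S2 := small _ _ c1 z0.
have {}E1 : `|'D_u f (x + (h *: v + c *: u)) - 'D_u f x
    - 'd ('D_u f) x (h *: v + c *: u)| <= e / N * (h * N - h - h * `|u|).
  by apply: le_trans E1 _; rewrite ler_wpM2l// ltW.
have {S2}E2 : `|'D_u f (x + (0 *: v + c *: u)) - 'D_u f x
    - 'd ('D_u f) x (0 *: v + c *: u)| <= e / N * (h * `|u|).
  apply: le_trans E2 _; rewrite scale0r add0r normrZ ger0_norm//.
  by rewrite ler_wpM2l ?(ltW eN)// ler_wpM2r.
move: E1 E2; rewrite addrA scale0r add0r linearD linearZ /= -deriveE// => E1 E2.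
have -> : g h - g 0 - h ^+ 2 * 'D_v ('D_u f) x =
   h * (('D_u f (x + h *: v + c *: u) - 'D_u f x - (h *: 'D_v ('D_u f) x + 'd ('D_u f) x (c *: u)))
      - ('D_u f (x + c *: u) - 'D_u f x - 'd ('D_u f) x (c *: u))).
  by rewrite gE /dg /GRing.scale /=; ring.
rewrite normrM gtr0_norm// expr2 mulrCA ler_pM2l//.
apply: le_trans (ler_normB _ _) _; apply: le_trans (lerD E1 E2) _.
rewrite -mulrDr -mulrA ler_wpM2l ?(ltW e0)// mulrC ler_pdivrMr//; lra.
Qed.

(** Schwarz's theorem: both iterated derivatives approximate the same second
    difference quotient. *)
Lemma derive_comm (f : V -> R) x u v :
  (\near x, differentiable f x) -> differentiable ('D_u f) x ->
  differentiable ('D_v f) x -> 'D_v ('D_u f) x = 'D_u ('D_v f) x.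
Proof.
move=> Df Du Dv; apply/eqP; rewrite -subr_eq0 -normr_le0.
apply/ler_addgt0Pl => e e0; rewrite addr0.
have e2 : 0 < e / 2 by exact: divr_gt0.
have [d1 d10 H1] := second_difference v Df Du e2.
have [d2 d20 H2] := second_difference u Df Dv e2.
pose h := Num.min d1 d2 / 2.
have m0 : 0 < Num.min d1 d2 by rewrite lt_min d10.
have h0 : 0 < h by exact: divr_gt0.
have hm : h < Num.min d1 d2 by rewrite /h; lra.
have /andP[hd1 hd2] : (h < d1) && (h < d2) by rewrite -lt_min.
clearbody h; have {H1 H2}:= lerD (H1 h h0 hd1) (H2 h h0 hd2).
move=> /(le_trans (ler_normB _ _)).
rewrite (addrAC x (h *: u)).
move: ('D_v ('D_u f) x) ('D_u ('D_v f) x) => a b.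
move: (f (x + h *: v + h *: u)) (f _) (f _) (f _) => p q y z.
have h20 : 0 < h ^+ 2 by exact: exprn_gt0.
rewrite (_ : _ - _ = h ^+ 2 * (b - a)); last by ring.
have -> : e / 2 * h ^+ 2 + e / 2 * h ^+ 2 = h ^+ 2 * e by field.
by rewrite normrM (gtr0_norm h20) (ler_pM2l h20) distrC.
Qed.

End Symmetry.

(** * The rescaled bracket in terms of gradients *)

Section Trivector.
Variable R : realType.
Implicit Types (L c n q a b : 'cV[R]_3).

(** The Jacobi identity of the Lie algebra e(3), paired with the point (L, c) of
    its dual. *)
Lemma cyclic_e3 L c a1 a2 a3 b1 b2 b3 :
  let T a b a' b' a'' b'' := dot (cross L a + cross c b) (cross a' a'')
    + dot (cross c a) (cross a' b'' - cross a'' b') in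
  T a1 b1 a2 b2 a3 b3 + T a2 b2 a3 b3 a1 b1 + T a3 b3 a1 b1 a2 b2 = 0.
Proof. rewrite /= !vecE; ring. Qed.

Lemma cyclic_cross c a1 a2 a3 :
  dot (cross c a1) (cross a2 a3) + dot (cross c a2) (cross a3 a1)
  + dot (cross c a3) (cross a1 a2) = 0.
Proof. rewrite !vecE; ring. Qed.

(** With N = n x c the terms [n . (c x a)] are [N . a].  The cyclic sum of
    [(N . a) (L . (a' x a''))] is (N . L) det (a1, a2, a3), and that of
    [(n . (L x a)) (c . (a' x a''))] is its opposite; the terms in b are N . c
    times determinants, and those in q are (q x c) . c times one: they vanish
    as N and q x c are orthogonal to c. *)
Lemma cyclic_density L c n q a1 a2 a3 b1 b2 b3 :
  let T a b a' b' a'' b'' :=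
    dot n (cross c a) * (dot L (cross a' a'') + dot c (cross a' b'' - cross a'' b'))
    + (dot n (cross L a + cross c b) + dot q (cross c a)) * dot c (cross a' a'') in
  T a1 b1 a2 b2 a3 b3 + T a2 b2 a3 b3 a1 b1 + T a3 b3 a1 b1 a2 b2 = 0.
Proof. rewrite /= !vecE; ring. Qed.
End Trivector.

Section GradientBracket.
Variables (R : realType) (mass r : R) (J : 'rV[R]_3).
Hypotheses (mass_gt0 : 0 < mass) (r_gt0 : 0 < r) (J_gt0 : forall i, 0 < J 0 i).

Notation V := ('cV[R]_3 * 'cV[R]_3)%type.
Notation k := (mass * r ^+ 2).
Implicit Types (z v : V) (F G : V -> R).

Lemma mr2_gt0 : 0 < k. Proof. by rewrite mulr_gt0// exprn_gt0. Qed.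

Definition Ainv (u : 'cV[R]_3) : 'cV[R]_3 := invmx (Amx mass r J) *m u.

Lemma AinvE u i : Ainv u i 0 = (J 0 i + k)^-1 * u i 0.
Proof.
have Jk_neq0 j : J 0 j + k != 0 by rewrite gt_eqF// addr_gt0// mr2_gt0.
pose D := diag_mx (\row_j (J 0 j + k)^-1).
have DA : D *m Amx mass r J = 1%:M.
  apply/matrixP => a b; rewrite mul_diag_mx !mxE -mulrnDl mulrnAr mulVf//.
have /mulmx1_unit[_ Au] := DA.
have -> : Ainv u = D *m u by rewrite /Ainv -[D](mulmxK Au) DA mul1mx.
by rewrite mul_diag_mx !mxE.
Qed.

(** The component along the vertical of the angular velocity, in terms of
    (K, gamma); see [spin_angvel]. *)
Definition spin z : R := dot z.1 (Ainv z.2) / Yfun mass r J z.2.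

Definition Lvec z : 'cV[R]_3 := z.1 - (k * spin z) *: z.2.

Definition gradK G z : 'cV[R]_3 := \col_i 'D_(delta_mx i 0, 0) G z.
Definition gradgam G z : 'cV[R]_3 := \col_i 'D_(0, delta_mx i 0) G z.

Definition bivector (L c a1 b1 a2 b2 : 'cV[R]_3) : R :=
  - (dot L (cross a1 a2) + dot c (cross a1 b2 - cross a2 b1)).

Definition gradbr G1 G2 z : R :=
  mu mass r J z.2
  * bivector (Lvec z) z.2 (gradK G1 z) (gradgam G1 z) (gradK G2 z) (gradgam G2 z).

(** The Hamiltonian vector field of G: the bracket of G with H is the derivative
    of H along it ([gradbrE]). *)
Definition hamvec G z : V :=
  (- mu mass r J z.2 *: (cross (Lvec z) (gradK G z) + cross z.2 (gradgam G z)),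
   - mu mass r J z.2 *: cross z.2 (gradK G z)).

Lemma sum_delta_mx (u : 'cV[R]_3) : u = \sum_i u i 0 *: delta_mx i 0.
Proof.
by rewrite {1}(matrix_sum_delta u); apply: eq_bigr => i _; rewrite big_ord1.
Qed.

Lemma deriveE_grad G z v : differentiable G z ->
  'D_v G z = dot (gradK G z) v.1 + dot (gradgam G z) v.2.
Proof.
move=> DG.
have vE : v = \sum_i v.1 i 0 *: (delta_mx i 0, 0 : 'cV[R]_3) + \sum_i v.2 i 0 *: (0 : 'cV[R]_3, delta_mx i 0).
  rewrite [LHS]surjective_pairing [RHS]surjective_pairing; congr pair.
    rewrite linearD !linear_sum /= [X in _ + X]big1 ?addr0 -?sum_delta_mx//.
    by move=> i _; rewrite scaler0.
  rewrite linearD !linear_sum /= [X in X + _]big1 ?add0r -?sum_delta_mx//.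
  by move=> i _; rewrite scaler0.
rewrite [in LHS]vE deriveE// linearD !linear_sum /=; congr (_ + _); apply: eq_bigr => i _.
  by rewrite linearZ mxE deriveE// mulrC.
by rewrite linearZ mxE deriveE// mulrC.
Qed.

Lemma Ainv_sym (u v : 'cV[R]_3) : dot u (Ainv v) = dot v (Ainv u).
Proof. by rewrite !dotE !AinvE; ring. Qed.

Lemma is_diff_pr1 z : is_diff z (fun y : V => y.1) (fun v => v.1).
Proof. exact: is_diff_fstf (is_diff_id z). Qed.

Lemma is_diff_pr2 z : is_diff z (fun y : V => y.2) (fun v => v.2).
Proof. exact: is_diff_sndf (is_diff_id z). Qed.

Lemma is_diff_Y z : is_diff z (fun y : V => Yfun mass r J y.2)
  (fun v => - (2 * k) * dot (Ainv z.2) v.2).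
Proof.
have H2 := is_diff_pr2 z.
apply: is_diff_dfE (is_diff_subf (is_diff_cstf z (1 : R))
  (is_diff_mulf (is_diff_cstf z k) (is_diff_dot H2
    (is_diff_mulmxr (invmx (Amx mass r J)) H2)))) _ => v /=.
by rewrite -!/(Ainv _) !dotE !AinvE; ring.
Qed.

Lemma mu_gt0 z : 0 < Yfun mass r J z.2 -> 0 < mu mass r J z.2.
Proof. by rewrite sqrtr_gt0. Qed.

Lemma mu_sqr z : 0 < Yfun mass r J z.2 -> mu mass r J z.2 ^+ 2 = Yfun mass r J z.2.
Proof. by move=> /ltW /sqr_sqrtr. Qed.

Lemma is_diff_mu z : 0 < Yfun mass r J z.2 ->
  is_diff z (fun y : V => mu mass r J y.2)
    (fun v => - k * dot (Ainv z.2) v.2 / mu mass r J z.2).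
Proof.
move=> Y0; have H := @is_diff_sqrtf _ _ _ (fun y : V => Yfun mass r J y.2) _ Y0 (is_diff_Y z).
apply: is_diff_dfE H _ => v.
rewrite -/(mu mass r J z.2).
have : mu mass r J z.2 != 0 by rewrite gt_eqF// mu_gt0.
by move=> mu0; field.
Qed.

Definition dspin z v : R :=
  (dot (Ainv z.2) v.1 + dot (Ainv z.1 + (2 * k * spin z) *: Ainv z.2) v.2)
  / Yfun mass r J z.2.

Lemma is_diff_spin z : 0 < Yfun mass r J z.2 -> is_diff z spin (dspin z).
Proof.
move=> Y0; have Yn0 : Yfun mass r J z.2 != 0 by rewrite gt_eqF.
have Hd := is_diff_dot (is_diff_pr1 z)
  (is_diff_mulmxr (invmx (Amx mass r J)) (is_diff_pr2 z)).
have Hi := @is_diff_invf _ _ _ (fun y : V => Yfun mass r J y.2) _ Yn0 (is_diff_Y z).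
apply: is_diff_dfE (is_diff_mulf Hd Hi) _ => v /=.
rewrite -!/(Ainv _) [dot z.1 (Ainv v.2)]Ainv_sym /dspin /spin.
move: (Yfun mass r J z.2) (Ainv z.2) (Ainv z.1) Yn0 => Y n p Yn0.
by rewrite !vecE; field.
Qed.

Definition dLvec z v : 'cV[R]_3 :=
  v.1 - ((k * dspin z v) *: z.2 + (k * spin z) *: v.2).

Lemma is_diff_Lvec z : 0 < Yfun mass r J z.2 -> is_diff z Lvec (dLvec z).
Proof.
move=> Y0; apply: is_diff_dfE (is_diff_subf (is_diff_pr1 z) (is_diff_scale
  (is_diff_mulf (is_diff_cstf z k) (is_diff_spin Y0)) (is_diff_pr2 z))) _ => v /=.
by rewrite mul0r add0r.
Qed.

Definition twice_diff G z :=
  (\near z, differentiable G z) /\ forall v, differentiable ('D_v G) z.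

Definition hessK G z v : 'cV[R]_3 := \col_i 'D_v ('D_(delta_mx i 0, 0) G) z.
Definition hessgam G z v : 'cV[R]_3 := \col_i 'D_v ('D_(0, delta_mx i 0) G) z.

Lemma is_diff_gradK G z : twice_diff G z -> is_diff z (gradK G) (hessK G z).
Proof.
move=> [_ D2]; apply: is_diff_mx => i j.
rewrite (_ : (fun y => _) = 'D_(delta_mx i 0, 0) G); last by apply/funext => y; rewrite mxE.
apply: is_diff_dfE (differentiableP (D2 _)) _ => v.
by rewrite mxE deriveE.
Qed.

Lemma is_diff_gradgam G z : twice_diff G z -> is_diff z (gradgam G) (hessgam G z).
Proof.
move=> [_ D2]; apply: is_diff_mx => i j.
rewrite (_ : (fun y => _) = 'D_(0, delta_mx i 0) G); last by apply/funext => y; rewrite mxE.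
apply: is_diff_dfE (differentiableP (D2 _)) _ => v.
by rewrite mxE deriveE.
Qed.

(** The Hessian on (v, u), in a form in which u may be a vector that varies with
    the point while only the gradient is differentiated. *)
Definition hess G z v u : R := dot (hessK G z v) u.1 + dot (hessgam G z v) u.2.

Lemma hessE G z v u : twice_diff G z -> hess G z v u = 'D_v ('D_u G) z.
Proof.
move=> D2; have D1 := D2.1.
have H : is_diff z (fun y => dot (gradK G y) u.1 + dot (gradgam G y) u.2)
                   (fun v => hess G z v u).
  apply: is_diff_dfE (is_diff_addf (is_diff_dot (is_diff_gradK D2) (is_diff_cstf z u.1))
     (is_diff_dot (is_diff_gradgam D2) (is_diff_cstf z u.2))) _ => w /=.
  have dot0 (a : 'cV[R]_3) : dot a 0 = 0 by rewrite !vecE; ring.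
  by rewrite /hess [dot (gradK G z) 0]dot0 [dot (gradgam G z) 0]dot0 !addr0.
suff /is_diff_derive -> : is_diff z ('D_u G) (fun v => hess G z v u) by [].
apply: is_diff_near H _; near=> y; rewrite deriveE_grad//.
by near: y; exact: D1.
Unshelve. all: by end_near. Qed.

Lemma hess_sym G z v u : twice_diff G z -> hess G z v u = hess G z u v.
Proof.
move=> D2; have [D1 D] := D2; rewrite (hessE v u D2) (hessE u v D2).
exact: derive_comm D1 (D u) (D v).
Qed.

Lemma mu_bivectorE G z (a b : 'cV[R]_3) :
  mu mass r J z.2 * bivector (Lvec z) z.2 (gradK G z) (gradgam G z) a b
  = dot a (hamvec G z).1 + dot b (hamvec G z).2.
Proof.
rewrite /hamvec /bivector /=.
move: (gradK G z) (gradgam G z) (Lvec z) (mu _ _ _ _) => a1 b1 L m.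
by rewrite !vecE; ring.
Qed.

Lemma mu_bivectorN G z (a b : 'cV[R]_3) :
  mu mass r J z.2 * bivector (Lvec z) z.2 a b (gradK G z) (gradgam G z)
  = - (dot a (hamvec G z).1 + dot b (hamvec G z).2).
Proof.
rewrite /hamvec /bivector /=.
move: (gradK G z) (gradgam G z) (Lvec z) (mu _ _ _ _) => a1 b1 L m.
by rewrite !vecE; ring.
Qed.

(** The part of the derivative of the bracket that comes from the coefficients
    mu, L and gamma, the gradients being kept fixed. *)
Definition dgradbr G1 G2 z v : R :=
  - k * dot (Ainv z.2) v.2 / mu mass r J z.2
    * bivector (Lvec z) z.2 (gradK G1 z) (gradgam G1 z) (gradK G2 z) (gradgam G2 z)
  + mu mass r J z.2
    * bivector (dLvec z v) v.2 (gradK G1 z) (gradgam G1 z) (gradK G2 z) (gradgam G2 z).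

(** The bivector applied to the gradient of G1 and to the derivative of the
    gradient of G2 is that derivative evaluated on the Hamiltonian vector of
    G1, and conversely with the opposite sign. *)
Lemma is_diff_gradbr G1 G2 z : 0 < Yfun mass r J z.2 ->
  twice_diff G1 z -> twice_diff G2 z ->
  is_diff z (gradbr G1 G2) (fun v =>
    dgradbr G1 G2 z v + hess G2 z v (hamvec G1 z) - hess G1 z v (hamvec G2 z)).
Proof.
move=> Y0 T1 T2.
have Hc := is_diff_pr2 z; have HL := is_diff_Lvec Y0; have Hm := is_diff_mu Y0.
have [A1 A2] := (is_diff_gradK T1, is_diff_gradK T2).
have [B1 B2] := (is_diff_gradgam T1, is_diff_gradgam T2).
apply: is_diff_dfE (is_diff_mulf Hm (is_diff_oppf (is_diff_addf
  (is_diff_dot HL (is_diff_cross A1 A2))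
  (is_diff_dot Hc (is_diff_subf (is_diff_cross A1 B2) (is_diff_cross A2 B1)))))) _ => v /=.
have -> : hess G2 z v (hamvec G1 z) = mu mass r J z.2 *
    bivector (Lvec z) z.2 (gradK G1 z) (gradgam G1 z) (hessK G2 z v) (hessgam G2 z v).
  exact/esym/mu_bivectorE.
have -> : - hess G1 z v (hamvec G2 z) = mu mass r J z.2 *
    bivector (Lvec z) z.2 (hessK G1 z v) (hessgam G1 z v) (gradK G2 z) (gradgam G2 z).
  exact/esym/mu_bivectorN.
rewrite /dgradbr /bivector.
move: (mu mass r J z.2) (- k * dot (Ainv z.2) v.2 / _) => m dm.
move: (gradK G1 z) (gradK G2 z) (gradgam G1 z) (gradgam G2 z) (Lvec z) (dLvec z v)
  (hessK G1 z v) (hessK G2 z v) (hessgam G1 z v) (hessgam G2 z v)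
  => a1 a2 b1 b2 L dL da1 da2 db1 db2.
by rewrite !vecE; ring.
Qed.

Lemma gradbrE G1 G2 z : differentiable G2 z ->
  gradbr G1 G2 z = 'D_(hamvec G1 z) G2 z.
Proof. by move=> D; rewrite /gradbr mu_bivectorE deriveE_grad. Qed.

(** The derivative of mu along [hamvec G] is k n . (gamma x a), without
    denominator, and mu times the derivative of the spin has no denominator
    either, since mu^2 = Y.  The sum then splits into mu^2 times the identity
    of e(3), mu^2 k times the spin times the identity of so(3), and k times
    the terms of [cyclic_density]. *)
Lemma dgradbr_cyclic G1 G2 G3 z : 0 < Yfun mass r J z.2 ->
  dgradbr G2 G3 z (hamvec G1 z) + dgradbr G3 G1 z (hamvec G2 z)
  + dgradbr G1 G2 z (hamvec G3 z) = 0.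
Proof.
move=> Y0; have m0 : mu mass r J z.2 != 0 by rewrite gt_eqF// mu_gt0.
have dg F G H : dgradbr G H z (hamvec F z) =
  let: (a1, b1, a2, b2, a3, b3) := (gradK F z, gradgam F z, gradK G z, gradgam G z, gradK H z, gradgam H z) in
  let L := Lvec z in let c := z.2 in let n := Ainv z.2 in
  mu mass r J z.2 ^+ 2 * (dot (cross L a1 + cross c b1) (cross a2 a3)
    + dot (cross c a1) (cross a2 b3 - cross a3 b2))
  - mu mass r J z.2 ^+ 2 * k * spin z * dot (cross c a1) (cross a2 a3)
  - k * (dot n (cross c a1) * (dot L (cross a2 a3) + dot c (cross a2 b3 - cross a3 b2))
    + (dot n (cross L a1 + cross c b1)
       + dot (Ainv z.1 + (2 * k * spin z) *: n) (cross c a1)) * dot c (cross a2 a3)).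
  rewrite /= /dgradbr /bivector /dLvec /dspin -mu_sqr//=.
  move: (mu _ _ _ _) (spin z) (Ainv z.2) (Ainv z.1) (Lvec z) m0 => m s n p L m0.
  move: (gradK F z) (gradgam F z) (gradK G z) (gradgam G z) (gradK H z) (gradgam H z)
    => a1 b1 a2 b2 a3 b3.
  set u := cross L a1 + cross z.2 b1; set w := cross z.2 a1.
  set x := cross a2 a3; set y := cross a2 b3 - cross a3 b2.
  move: u w x y => u w x y.
  by rewrite !vecE; field.
have comb (m l s x1 x2 x3 w1 w2 w3 y1 y2 y3 : R) :
    x1 + x2 + x3 = 0 -> w1 + w2 + w3 = 0 -> y1 + y2 + y3 = 0 ->
    m * x1 - m * l * s * w1 - l * y1 + (m * x2 - m * l * s * w2 - l * y2)
    + (m * x3 - m * l * s * w3 - l * y3) = 0.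
  move=> xE wE yE.
  transitivity (m * (x1 + x2 + x3) - m * l * s * (w1 + w2 + w3)
    - l * (y1 + y2 + y3)); first by ring.
  by rewrite xE wE yE !mulr0 !subr0.
rewrite !dg; apply: comb.
- exact: cyclic_e3.
- exact: cyclic_cross.
- exact: cyclic_density.
Qed.

Lemma gradbr_gradbrE G1 G2 G3 z : 0 < Yfun mass r J z.2 ->
  twice_diff G2 z -> twice_diff G3 z ->
  gradbr G1 (gradbr G2 G3) z = dgradbr G2 G3 z (hamvec G1 z)
    + hess G3 z (hamvec G1 z) (hamvec G2 z) - hess G2 z (hamvec G1 z) (hamvec G3 z).
Proof.
move=> Y0 T2 T3; have H23 := is_diff_gradbr Y0 T2 T3.
exact: etrans (gradbrE _ (@ex_diff _ _ _ _ _ _ _ H23)) (is_diff_derive _ H23).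
Qed.

(** Each Hessian is met twice, on the Hamiltonian vectors of the two other
    functions in either order, and with opposite signs. *)
Lemma gradbr_jacobi G1 G2 G3 z : 0 < Yfun mass r J z.2 ->
  twice_diff G1 z -> twice_diff G2 z -> twice_diff G3 z ->
  gradbr G1 (gradbr G2 G3) z + gradbr G2 (gradbr G3 G1) z
  + gradbr G3 (gradbr G1 G2) z = 0.
Proof.
move=> Y0 T1 T2 T3.
have cancel (d1 d2 d3 h1 h1' h2 h2' h3 h3' : R) : h1 = h1' -> h2 = h2' ->
    h3 = h3' -> d1 + d2 + d3 = 0 ->
    d1 + h3 - h2 + (d2 + h1 - h3') + (d3 + h2' - h1') = 0 by lra.
rewrite (gradbr_gradbrE G1 Y0 T2 T3) (gradbr_gradbrE G2 Y0 T3 T1)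
  (gradbr_gradbrE G3 Y0 T1 T2).
apply: cancel (dgradbr_cyclic G1 G2 G3 Y0); exact: hess_sym.
Qed.

End GradientBracket.

(** * Rotations *)

Lemma det3E (R : realType) (A : 'M[R]_3) : \det A =
  A 0 0 * (A 1 1 * A 2%:R 2%:R - A 1 2%:R * A 2%:R 1)
  - A 0 1 * (A 1 0 * A 2%:R 2%:R - A 1 2%:R * A 2%:R 0)
  + A 0 2%:R * (A 1 0 * A 2%:R 1 - A 1 1 * A 2%:R 0).
Proof.
pose B i j := A (inord i) (inord j).
have AE i j : A i j = B i j by rewrite /B !inord_val.
rewrite (expand_det_row _ 0) sum3E /cofactor !(expand_det_row _ ord0).
rewrite !big_ord_recl !big_ord0 /cofactor !det_mx11 !mxE !AE /= /bump /=.
ring.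
Qed.

Section Rotations.
Variable R : realType.
Implicit Types (g A : 'M[R]_3) (u v w : 'cV[R]_3).

Lemma hatE w : (hat w 0 0 = 0) * (hat w 0 1 = - w 2%:R 0) * (hat w 0 2%:R = w 1 0) *
  (hat w 1 0 = w 2%:R 0) * (hat w 1 1 = 0) * (hat w 1 2%:R = - w 0 0) *
  (hat w 2%:R 0 = - w 1 0) * (hat w 2%:R 1 = w 0 0) * (hat w 2%:R 2%:R = 0).
Proof. by do !split; rewrite mxE crossE !mxE /= ?mulr0 ?mulr1 ?subr0 ?sub0r. Qed.

Lemma hat_mulmx w u : hat w *m u = cross w u.
Proof. by apply: col3P; rewrite mulmx3E !hatE crossE; ring. Qed.

Lemma hat_linear (a : R) u v : hat (a *: u + v) = a *: hat u + hat v.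
Proof. by apply/matrixP => i j; rewrite !mxE; ring. Qed.

Lemma trmx_hat w u : (hat w)^T *m u = cross u w.
Proof. by apply: col3P; rewrite mulmx3E 3![(hat w)^T _ _]mxE !hatE crossE; ring. Qed.

Lemma mulmx33E A B i j :
  (A *m B : 'M[R]_3) i j = A i 0 * B 0 j + A i 1 * B 1 j + A i 2%:R * B 2%:R j.
Proof. by rewrite mxE sum3E. Qed.

Lemma SO3_mulmx g A : SO3 g -> SO3 A -> SO3 (g *m A).
Proof.
move=> [g1 g2] [h1 h2]; split; last by rewrite det_mulmx g2 h2 mulr1.
by rewrite trmx_mul mulmxA -(mulmxA _ g^T) g1 mulmx1.
Qed.

Lemma SO3_invmx g : SO3 g -> invmx g = g^T.
Proof.
move=> [g1 _]; have [_ gu] := mulmx1_unit g1.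
by rewrite -[LHS]mul1mx -g1 mulmxK.
Qed.

Lemma SO3_dot g u v : SO3 g -> dot (g *m u) (g *m v) = dot u v.
Proof.
have dE a b : dot a b = (a^T *m b) 0 0 by rewrite mxE; apply: eq_bigr => i _; rewrite mxE.
by move=> [g1 _]; rewrite !dE trmx_mul mulmxA -(mulmxA _ g^T) g1 mulmx1.
Qed.

(** A rotation about the axis w when the coefficients satisfy the relation of
    [rodrigues_SO3], which has rational solutions besides the trigonometric
    ones. *)
Definition rodrigues w (a b : R) : 'M[R]_3 :=
  1%:M + a *: hat w + b *: (hat w *m hat w).

(** As hat w ^ 3 = - |w|^2 hat w, the product of the matrix with its transpose is
    1 + (2 b - |w|^2 b^2 - a^2) hat w ^ 2. *)
Lemma rodrigues_SO3 w a b : 2 * b = dot w w * b ^+ 2 + a ^+ 2 ->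
  SO3 (rodrigues w a b).
Proof.
rewrite dotE => ab.
(* multiples of the relation between a and b, to be subtracted before ring *)
have relE c : c * (2 * b - ((w 0 0 * w 0 0 + w 1 0 * w 1 0 + w 2%:R 0 * w 2%:R 0)
    * b ^+ 2 + a ^+ 2)) = 0 :> R.
  by rewrite ab subrr mulr0.
have mE i j : rodrigues w a b i j = (i == j)%:R + a * hat w i j
    + b * (hat w i 0 * hat w 0 j + hat w i 1 * hat w 1 j + hat w i 2%:R * hat w 2%:R j).
  by rewrite 2!mxE [X in _ + X]mxE mulmx33E [X in X + _ + _]mxE [X in _ + X + _]mxE.
split.
  apply/matrixP => i j; rewrite mulmx33E 3![(rodrigues w a b)^T _ _]mxE [RHS]mxE !mE.
  rewrite -[RHS]addr0 -(relE (hat w i 0 * hat w 0 j + hat w i 1 * hat w 1 j + hat w i 2%:R * hat w 2%:R j)).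
  by elim/ord3P: i; elim/ord3P: j; rewrite !hatE /=; ring.
rewrite det3E -[RHS]subr0 -(relE (w 0 0 * w 0 0 + w 1 0 * w 1 0 + w 2%:R 0 * w 2%:R 0)).
by rewrite !mE !hatE /=; ring.
Qed.

(** The Cayley transform of t w / 2: a curve with rational entries, which exists
    for w = 0 as well as for w <> 0. *)
Lemma SO3_curve w : exists c : R -> 'M[R]_3,
  [/\ c 0 = 1%:M, forall t, SO3 (c t) & is_diff (0 : R) c (fun t => t *: hat w)].
Proof.
pose d (t : R) := 1 + dot w w / 4 * t ^+ 2.
have w0 : 0 <= dot w w by apply: sumr_ge0 => i _; rewrite -expr2 sqr_ge0.
have d_gt0 t : 0 < d t.
  by rewrite ltr_pwDl// mulr_ge0 ?sqr_ge0// divr_ge0.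
have dn0 t : d t != 0 by rewrite gt_eqF.
pose a t := t / d t; pose b t := t ^+ 2 / 2 / d t.
exists (fun t => rodrigues w (a t) (b t)); split.
- by rewrite /rodrigues /a /b expr0n !mul0r !scale0r !addr0.
- move=> t; apply: rodrigues_SO3; rewrite /a /b.
  have dE : dot w w * t ^+ 2 = 4 * (d t - 1) by rewrite /d; field.
  rewrite (_ : dot w w * _ = dot w w * t ^+ 2 * (t ^+ 2 / 4 / d t ^+ 2)); last first.
    by have := dn0 t => dt0; field.
  by rewrite dE; have := dn0 t => dt0; field.
- have Ht : is_diff (0 : R) (fun t : R => t) (fun t => t) by exact: is_diff_id.
  have H2 : is_diff (0 : R) (fun t : R => t ^+ 2) (fun t => 0).
    apply: is_diff_dfE (is_diff_mulf Ht Ht) _ => t; ring.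
  have Hd : is_diff (0 : R) d (fun=> 0).
    apply: is_diff_dfE (is_diff_addf (is_diff_cstf _ (1 : R))
     (is_diff_mulf (is_diff_cstf _ (dot w w / 4)) H2)) _ => t /=; ring.
  have Hi := is_diff_invf (dn0 0) Hd.
  have Ha : is_diff (0 : R) a (fun t => t).
    apply: is_diff_dfE (is_diff_mulf Ht Hi) _ => t /=.
    by rewrite /d expr0n /=; field.
  have Hb : is_diff (0 : R) b (fun=> 0).
    apply: is_diff_dfE (is_diff_mulf (is_diff_mulf H2 (is_diff_cstf _ (2^-1 : R))) Hi) _ => t /=.
    by rewrite expr0n /=; ring.
  apply: is_diff_dfE (is_diff_addf (is_diff_addf (is_diff_cstf _ (1%:M : 'M[R]_3))
    (is_diff_scalef (hat w) Ha)) (is_diff_scalef (hat w *m hat w) Hb)) _ => t /=.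
  by rewrite add0r scale0r addr0.
Qed.

End Rotations.

Section Stereographic.
Variable R : realType.

(** In the stereographic coordinates (p, q) of a point of the sphere other than
    the pole e3, the product of diag (-1, 1, 1) and of the reflection exchanging
    that point and e3 is a rotation with rational entries. *)
Lemma stereographic_SO3 (p q : R) : let N := 1 + p ^+ 2 + q ^+ 2 in
  exists2 g : 'M[R]_3, SO3 g &
    g^T *m e3 R = \col_i (if i == 0 then 2 * p / N else
                          if i == 1 then 2 * q / N else 1 - 2 / N).
Proof.
move=> N; have N0 : N != 0.
  by rewrite gt_eqF// /N -addrA ltr_pwDl// addr_ge0// sqr_ge0.
pose g : 'M[R]_3 := \matrix_(i, j)
  if i == 0 then
    if j == 0 then 2 * p ^+ 2 / N - 1 else if j == 1 then 2 * p * q / N else - (2 * p / N)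
  else if i == 1 then
    if j == 0 then - (2 * p * q / N) else if j == 1 then 1 - 2 * q ^+ 2 / N else 2 * q / N
  else if j == 0 then 2 * p / N else if j == 1 then 2 * q / N else 1 - 2 / N.
have gE : (g 0 0 = 2 * p ^+ 2 / N - 1) * (g 0 1 = 2 * p * q / N) * (g 0 2%:R = - (2 * p / N))
  * (g 1 0 = - (2 * p * q / N)) * (g 1 1 = 1 - 2 * q ^+ 2 / N) * (g 1 2%:R = 2 * q / N)
  * (g 2%:R 0 = 2 * p / N) * (g 2%:R 1 = 2 * q / N) * (g 2%:R 2%:R = 1 - 2 / N).
  by rewrite !mxE.
exists g; first split.
- apply/matrixP => i j; rewrite mulmx33E 3![g^T _ _]mxE [RHS]mxE.
  by elim/ord3P: i; elim/ord3P: j; rewrite !gE /= /N; field; exact: N0.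
- by rewrite det3E !gE /N; field; exact: N0.
- apply: col3P; rewrite mulmx3E 3![g^T _ _]mxE /e3 !gE !mxE /=; ring.
Qed.

Lemma SO3_transitive (c : 'cV[R]_3) : dot c c = 1 ->
  exists2 g : 'M[R]_3, SO3 g & g^T *m e3 R = c.
Proof.
rewrite dotE => c1; have [c3|c3] := eqVneq (c 2%:R 0) 1.
  have : c 0 0 * c 0 0 + c 1 0 * c 1 0 = 0.
    by apply: (addIr (c 2%:R 0 * c 2%:R 0)); rewrite c1 c3; ring.
  rewrite -!expr2 => /eqP; rewrite paddr_eq0 ?sqr_ge0// !sqrf_eq0 => /andP[/eqP c0 /eqP c1'].
  exists 1%:M; first by split; rewrite ?trmx1 ?mulmx1 ?det1.
  by rewrite trmx1 mul1mx; apply: col3P; rewrite /e3 mxE /= ?c0 ?c1' ?c3.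
have d0 : 1 - c 2%:R 0 != 0 by rewrite subr_eq0 eq_sym.
set d := 1 - c 2%:R 0 in d0.
have dE : c 2%:R 0 = 1 - d by rewrite /d; ring.
have [g gS gE] := stereographic_SO3 (c 0 0 / d) (c 1 0 / d).
exists g => //; rewrite gE.
have NE : 1 + (c 0 0 / d) ^+ 2 + (c 1 0 / d) ^+ 2 = 2 / d.
  apply: (mulIf d0); apply: (mulIf d0); rewrite divfK//.
  transitivity (d ^+ 2 + (c 0 0 * c 0 0 + c 1 0 * c 1 0)); first by field.
  rewrite (_ : c 0 0 * c 0 0 + c 1 0 * c 1 0 = 1 - c 2%:R 0 * c 2%:R 0).
    by rewrite dE; ring.
  by rewrite -c1; ring.
have two0 : (2 : R) != 0 by rewrite pnatr_eq0.
apply: col3P; rewrite mxE /= NE ?dE; field; rewrite ?d0 ?two0 //.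
Qed.
End Stereographic.

(** * The constraint distribution *)

Lemma is_diff_curve (R : realType) (W : normedModType R) (c : R -> W) (t : R) (l : W) :
  is_derive t (1 : R) c l <-> is_diff t c (fun s => s *: l).
Proof.
split=> [[D E]|H].
  apply: DiffDef; first exact/derivable1_diffP.
  by rewrite deriv1E// derive1E E.
apply: DeriveDef; first exact/diff_derivable/ex_diff.
by rewrite (is_diff_derive _ H) scale1r.
Qed.

Section Constraint.
Variables (R : realType) (mass r : R) (J : 'rV[R]_3).
Hypotheses (mass_gt0 : 0 < mass) (r_gt0 : 0 < r) (J_gt0 : forall i, 0 < J 0 i).
Implicit Types (x : phase R) (X : tangent R) (u w : 'cV[R]_3).

Notation I := (inertia J).

(** The rolling constraint is v = rollmx (g w), linear in the space angular
    velocity, so that it can be differentiated as a matrix product. *)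
Definition rollmx : 'M[R]_(2, 3) :=
  \matrix_(i < 2, j < 3) (if i == 0 then r * (j == 1)%:R else - r * (j == 0)%:R).

Lemma rollmxE u : ((rollmx *m u) 0 0 = r * u 1 0) * ((rollmx *m u) 1 0 = - r * u 0 0).
Proof.
by split; rewrite mxE sum3E !mxE /= ?(mulr1, mulr0, mul0r, add0r, addr0).
Qed.

Lemma rollingE (g : 'M[R]_3) w (v : 'cV[R]_2) :
  rolling r g w v <-> v = rollmx *m (g *m w).
Proof.
split=> [[v0 v1]|->]; last by rewrite /rolling !rollmxE.
apply/matrixP => i j; rewrite ord1; case: i => [[|[|//]] lt].
  by rewrite (_ : Ordinal lt = 0) ?v0 ?rollmxE//; exact: val_inj.
by rewrite (_ : Ordinal lt = 1) ?v1 ?rollmxE//; exact: val_inj.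
Qed.

Lemma rollmx_dot u w :
  dot (rollmx *m u) (rollmx *m w) = r ^+ 2 * (dot u w - u 2%:R 0 * w 2%:R 0).
Proof.
rewrite /dot big_ord_recl big_ord1 -!/(dot _ _).
rewrite (_ : lift ord0 ord0 = 1); last exact: val_inj.
by rewrite !rollmxE dotE; ring.
Qed.

Lemma inertiaE u i : (I *m u) i 0 = J 0 i * u i 0.
Proof. by rewrite mul_diag_mx mxE. Qed.

Lemma inertia_unit : I \in unitmx.
Proof.
have /mulmx1_unit[] // : I *m diag_mx (\row_j (J 0 j)^-1) = 1%:M.
apply/matrixP => a b; by rewrite mul_diag_mx !mxE mulrnAr mulfV// gt_eqF.
Qed.

Definition angvel x : 'cV[R]_3 := invmx I *m bmom x.

Lemma angvelK x : I *m angvel x = bmom x.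
Proof. by rewrite mulKVmx ?inertia_unit. Qed.

Lemma MsetE x : Mset mass r J x <->
  SO3 (rot x) /\ pmom x = mass *: (rollmx *m (rot x *m angvel x)).
Proof.
split=> [[gS [w [v [/rollingE -> Mw ->]]]]|[gS pE]].
  by split=> //; rewrite /angvel Mw mulKmx ?inertia_unit.
split=> //; exists (angvel x), (rollmx *m (rot x *m angvel x)).
by split; rewrite ?angvelK//; exact/rollingE.
Qed.

(** The variation of the state of angular velocity [angvel x] when the attitude
    moves with velocity u and the angular velocity with velocity w; the last
    component is the derivative of the momentum m v that the constraint
    imposes. *)
Definition constrained x u w : tangent R :=
  (u, rollmx *m (rot x *m u), I *m w,
   mass *: (rollmx *m (rot x *m (cross u (angvel x) + w)))).

Section PhaseCoordinates.
Variables (V : normedModType R) (c dc : V -> phase R) (x : V).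
Hypothesis H : is_diff x c dc.

Lemma is_diff_rot : is_diff x (fun y => rot (c y)) (fun y => rot (dc y)).
Proof. exact: is_diff_fstf (is_diff_fstf (is_diff_fstf H)). Qed.
Lemma is_diff_bmom : is_diff x (fun y => bmom (c y)) (fun y => bmom (dc y)).
Proof. exact: is_diff_sndf (is_diff_fstf H). Qed.
Lemma is_diff_pmom : is_diff x (fun y => pmom (c y)) (fun y => pmom (dc y)).
Proof. exact: is_diff_sndf H. Qed.
End PhaseCoordinates.

(** Differentiating the equation [pmom x = mass rollmx (g w)] of [MsetE] along a
    curve gives the last component of a tangent vector.  Conversely the curve
    (g R(t), w + t w'), R(t) a curve of rotations with velocity u, is lifted to
    Mset by that equation. *)
Lemma CdistP x X : Mset mass r J x ->
  (Cdist mass r J x X <-> exists w, X = constrained x (tw X) w).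
Proof.
move=> xM; split.
- move=> [[c [c0 cM /is_diff_curve cD]] /rollingE vE].
  exists (invmx I *m tM X).
  have Ep := is_diff_pmom cD.
  have El := is_diff_scale (is_diff_cstf _ mass) (is_diff_mulmxr rollmx
    (is_diff_mulmx (is_diff_rot cD) (is_diff_mulmxr (invmx I) (is_diff_bmom cD)))).
  have nE : \forall t \near (0 : R), pmom (c t) =
      mass *: (rollmx *m (rot (c t) *m (invmx I *m bmom (c t)))).
    by near=> t; have /MsetE[] : Mset mass r J (c t) by near: t.
  have := is_diff_derive (1 : R) Ep.
  rewrite (near_eq_derive _ nE) (is_diff_derive (1 : R) El) /= scale0r add0r !scale1r c0.
  rewrite /constrained mulKVmx ?inertia_unit// -vE => {cD vE Ep El}.
  move: X => [[[a b] d] e] /= <-.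
  by rewrite -mulmxA hat_mulmx [in RHS]mulmxDr.
- move=> [w XE].
  have [gS pE] := (MsetE x).1 xM.
  have vE : tv X = rollmx *m (rot x *m tw X) by rewrite [in LHS]XE.
  split; last exact/rollingE.
  have [c [c0 cS cD]] := SO3_curve (tw X).
  pose W t := angvel x + t *: w.
  exists (fun t => (rot x *m c t, x.1.1.2 + t *: tv X, I *m W t,
    mass *: (rollmx *m (rot x *m c t *m W t)))); split.
  + rewrite c0 mulmx1 /W !scale0r !addr0 angvelK -pE.
    by case: x {xM pE gS vE W XE} => [[[a b] d] e].
  + near=> t; split; first exact: SO3_mulmx.
    exists (W t), (rollmx *m (rot x *m c t *m W t)); split => //.
    exact/rollingE.
  + have HW : is_diff (0 : R) W (fun t => t *: w).
      apply: is_diff_dfE (is_diff_addf (is_diff_cstf _ (angvel x))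
        (is_diff_scalef w (is_diff_id (0 : R)))) _ => t /=.
      by rewrite add0r.
    have Hg := is_diff_mulmxr (rot x) cD.
    have Hq := is_diff_addf (is_diff_cstf _ x.1.1.2)
        (is_diff_scalef (tv X) (is_diff_id (0 : R))).
    have Hp := is_diff_scale (is_diff_cstf _ mass)
      (is_diff_mulmxr rollmx (is_diff_mulmx Hg HW)).
    apply/is_diff_curve.
    apply: is_diff_dfE (is_diff_pair (is_diff_pair (is_diff_pair Hg Hq)
      (is_diff_mulmxr I HW)) Hp) _ => t /=.
    rewrite add0r scale0r add0r /W scale0r addr0 c0 mulmx1.
    rewrite [in RHS]XE /ambient /constrained /=.
    rewrite -!scalemxAr -!scalemxAl -!scalerDr.
    rewrite -vE -mulmxA hat_mulmx -mulmxDr -!scalemxAr.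
    by rewrite scalerA [mass * t]mulrC -scalerA.
Unshelve. all: by end_near. Qed.
End Constraint.

(** * The affine almost symplectic form on the constraint distribution *)

Section Form.
Variables (R : realType) (mass r : R) (J : 'rV[R]_3).
Hypotheses (mass_gt0 : 0 < mass) (r_gt0 : 0 < r) (J_gt0 : forall i, 0 < J 0 i).
Implicit Types (x : phase R) (X Y Z : tangent R) (u w : 'cV[R]_3).

Notation I := (inertia J).
Notation k := (mass * r ^+ 2).
Notation OmT := (OmegaT mass r J).

Lemma ambient_linear x : linear (ambient x).
Proof.
move=> a X Y; rewrite /ambient /= hat_linear.
by rewrite mulmxDr -scalemxAr.
Qed.

Lemma linear_dot n (f : 'cV[R]_n -> R) :
  (forall a (u v : 'cV[R]_n), f (a *: u + v) = a * f u + f v) ->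
  exists c, forall u : 'cV[R]_n, f u = dot c u.
Proof.
move=> fl; exists (\col_i f (delta_mx i 0)) => u.
have f0 : f 0 = 0 by rewrite -[X in f X](addNr 0) -scaleN1r fl mulN1r addNr.
have fD a b : f (a + b) = f a + f b by rewrite -[a in LHS]scale1r fl mul1r.
have fZ a b : f (a *: b) = a * f b by rewrite -[X in f X]addr0 fl f0 addr0.
rewrite [in LHS](matrix_sum_delta u) (big_morph f fD f0); apply: eq_bigr => i _.
by rewrite big_ord1 fZ mxE mulrC.
Qed.

Definition linear_form (f : tangent R -> R) :=
  forall a X Y, f (a *: X + Y) = a * f X + f Y.

(** [OmegaQ x] and [OmegaT x] have the same shape, with different vectors rho. *)
Definition canonical_form (rho : 'cV[R]_3) X Y : R :=
  dot (tw X) (tM Y) - dot (tw Y) (tM X) + dot rho (cross (tw X) (tw Y))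
  + dot (tv X) (tp Y) - dot (tv Y) (tp X).

Lemma linear_formE (f : tangent R -> R) : linear_form f ->
  exists a b c d, forall Y,
    f Y = dot a (tw Y) + dot b (tv Y) + dot c (tM Y) + dot d (tp Y).
Proof.
move=> fl.
have fD X Y : f (X + Y) = f X + f Y by rewrite -[X in LHS]scale1r fl mul1r.
have [a aE] : exists c, forall u, f (u, 0, 0, 0) = dot c u.
  apply: linear_dot => s u v; rewrite -fl; congr f.
  by congr (_, _, _, _); rewrite /= ?scaler0 ?addr0.
have [b bE] : exists c, forall u : 'cV[R]_2, f (0, u, 0, 0) = dot c u.
  apply: linear_dot => s u v; rewrite -fl; congr f.
  by congr (_, _, _, _); rewrite /= ?scaler0 ?addr0.
have [c cE] : exists c, forall u, f (0, 0, u, 0) = dot c u.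
  apply: linear_dot => s u v; rewrite -fl; congr f.
  by congr (_, _, _, _); rewrite /= ?scaler0 ?addr0.
have [d dE] : exists c, forall u : 'cV[R]_2, f (0, 0, 0, u) = dot c u.
  apply: linear_dot => s u v; rewrite -fl; congr f.
  by congr (_, _, _, _); rewrite /= ?scaler0 ?addr0.
exists a, b, c, d => Y; rewrite -aE -bE -cE -dE -!fD; congr f.
by case: Y => [[[? ?] ?] ?]; congr (_, _, _, _); rewrite /= ?addr0 ?add0r.
Qed.

(** Such a form is nondegenerate whatever rho is. *)
Lemma sharpP rho (f : tangent R -> R) (Om : tangent R -> tangent R -> R) :
  (forall X Y, Om X Y = canonical_form rho X Y) -> linear_form f ->
  forall Y, Om (sharp Om f) Y = f Y.
Proof.
move=> OmE /linear_formE[a [b [c [d fE]]]].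
suff /getPex : exists X, [set X | forall Y, Om X Y = f Y] X by [].
exists (c, d, cross rho c - a, - b) => Y.
rewrite OmE fE /canonical_form /=.
rewrite [dot (tv Y) _]dotC (_ : dot (- b) _ = - dot b (tv Y)); last first.
  by rewrite -scaleN1r dotC dotZr mulN1r dotC.
rewrite !vecE; ring.
Qed.

Lemma dphase_linear (f : phase R -> R) x : linear_form (dphase f x).
Proof. by move=> a X Y; rewrite /dphase ambient_linear linearP. Qed.

(** [gamma] and [Kb] with the transpose of the attitude in place of its inverse:
    on Mset nothing changes, and the functions become polynomials on the whole
    ambient space of the phase space, differentiable everywhere. *)
Definition gamma_ext (x : phase R) : 'cV[R]_3 := (rot x)^T *m e3 R.

Definition Kb_ext x : 'cV[R]_3 :=
  bmom x + k *: (angvel J x - dot (angvel J x) (gamma_ext x) *: gamma_ext x).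

Definition pi_ext x := (Kb_ext x, gamma_ext x).

Definition dpi_ext x (v : phase R) :=
  (bmom v + k *: (angvel J v
     - ((dot (angvel J v) (gamma_ext x) + dot (angvel J x) (gamma_ext v)) *: gamma_ext x
     + dot (angvel J x) (gamma_ext x) *: gamma_ext v)), gamma_ext v).

Lemma is_diff_angvel x : is_diff x (angvel J) (angvel J).
Proof. exact: is_diff_mulmxr (is_diff_bmom (is_diff_id x)). Qed.

Lemma is_diff_gamma_ext x : is_diff x gamma_ext gamma_ext.
Proof.
apply: is_diff_dfE (is_diff_mulmx (is_diff_trmx (is_diff_rot (is_diff_id x)))
  (is_diff_cstf _ (e3 R))) _ => v /=.
by rewrite mulmx0 addr0.
Qed.

Lemma is_diff_pi_ext x : is_diff x pi_ext (dpi_ext x).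
Proof.
have Hg := is_diff_gamma_ext x; have Hw := is_diff_angvel x.
have HK := is_diff_addf (is_diff_bmom (is_diff_id x)) (is_diff_scale (is_diff_cstf _ k)
  (is_diff_subf Hw (is_diff_scale (is_diff_dot Hw Hg) Hg))).
apply: is_diff_dfE (is_diff_pair HK Hg) _ => v /=.
by rewrite scale0r add0r.
Qed.

Lemma invmx_inertiaE u i : (invmx I *m u) i 0 = (J 0 i)^-1 * u i 0.
Proof.
have Ji : J 0 i != 0 by rewrite gt_eqF.
apply: (mulfI Ji); rewrite -inertiaE mulKVmx ?inertia_unit//.
by rewrite mulVKf.
Qed.

(** Pairing the Hamiltonian vector with the vertical vector (0, 0, u, 0) isolates
    its first component: it is the derivative of the kinetic energy with
    respect to the body momentum. *)
Lemma XH_angvel x : tw (XH mass J x) = angvel J x.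
Proof.
have H := @sharpP (bmom x) _ (OmegaQ x) (fun _ _ => erefl) (dphase_linear (hamiltonian mass J) x).
have Hm := is_diff_bmom (is_diff_id x); have Hp := is_diff_pmom (is_diff_id x).
have HH : is_diff x (hamiltonian mass J) (fun v =>
  2^-1 * (dot (bmom v) (angvel J x) + dot (bmom x) (angvel J v))
  + (2 * mass)^-1 * (dot (pmom v) (pmom x) + dot (pmom x) (pmom v))).
  apply: is_diff_dfE (is_diff_addf
    (is_diff_mulf (is_diff_cstf _ (2^-1 : R)) (is_diff_dot Hm (is_diff_angvel x)))
    (is_diff_mulf (is_diff_cstf _ ((2 * mass)^-1 : R)) (is_diff_dot Hp Hp))) _ => v /=.
  by rewrite !mul0r !add0r.
have E u : dot (tw (XH mass J x)) u = dot (angvel J x) u.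
  have := H (0, 0, u, 0); rewrite -/(XH mass J x) /OmegaQ /= => HE.
  have z3 w : dot (0 : 'cV[R]_3) w = 0 by rewrite !vecE; ring.
  have z2 (w : 'cV[R]_2) : dot 0 w = 0 by rewrite /dot big1// => i _; rewrite mxE mul0r.
  rewrite (_ : cross _ 0 = 0) in HE; last by apply: col3P; rewrite !vecE; ring.
  rewrite z3 z2 [dot _ (0 : 'cV[R]_2)]dotC z2 [dot _ (0 : 'cV[R]_3)]dotC z3 in HE.
  rewrite !subr0 !addr0 in HE; rewrite HE /dphase (congr1 (fun h => h _) (@diff_val _ _ _ _ _ _ _ HH)).
  rewrite /= z2 [dot _ (0 : 'cV[R]_2)]dotC z2 addr0 mulr0 addr0 !dotE.
  by rewrite !invmx_inertiaE /=; field; rewrite ?gt_eqF.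
by apply: col3P; [have := E (delta_mx 0 0)|have := E (delta_mx 1 0)|have := E (delta_mx 2%:R 0)];
  rewrite !dotE !mxE /= !(mulr0, mulr1, addr0, add0r).
Qed.

Lemma OmegaTE x X Y : OmT x X Y = canonical_form (bmom x - k *: angvel J x) X Y.
Proof.
rewrite /OmegaT /nu XH_angvel /OmegaQ /canonical_form.
by move: (cross _ _) => c; rewrite !vecE; ring.
Qed.

(** The velocity of K along [constrained x u w]. *)
Definition Kdot x u w : 'cV[R]_3 :=
  I *m w + k *: (w
     - ((dot w (gamma_ext x) + dot (angvel J x) (cross (gamma_ext x) u)) *: gamma_ext x
     + dot (angvel J x) (gamma_ext x) *: cross (gamma_ext x) u)).

Lemma dpi_ext_constrained x u w :
  dpi_ext x (ambient x (constrained mass r J x u w)) = (Kdot x u w, cross (gamma_ext x) u).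
Proof.
rewrite /dpi_ext /ambient /constrained /angvel /gamma_ext /= mulKmx ?inertia_unit//.
by rewrite trmx_mul -mulmxA trmx_hat.
Qed.

(** The terms linear in gamma that come from the derivative of the projection
    w - (w . gamma) gamma in K cancel against those of the kinetic coupling
    m v . v', except for a multiple of (w . gamma) gamma; the volume term turns the
    coefficient I w + 2 k w into I w + k w, which is what K contains. *)
Lemma OmegaT_constrained x u1 w1 u2 w2 : SO3 (rot x) ->
  OmT x (constrained mass r J x u1 w1) (constrained mass r J x u2 w2) =
  dot u1 (Kdot x u2 w2) - dot u2 (Kdot x u1 w1)
  + dot (Kb_ext x - (k * dot (angvel J x) (gamma_ext x)) *: gamma_ext x) (cross u1 u2).
Proof.
move=> gS; rewrite OmegaTE /canonical_form /= !dotZr !rollmx_dot !SO3_dot//.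
have gE u : (rot x *m u) 2%:R 0 = dot u (gamma_ext x).
  by rewrite !dotE /gamma_ext mulmx3E /e3 !mulmx3E !mxE /=; ring.
rewrite !gE /Kdot /Kb_ext -(angvelK J_gt0 x).
move: (angvel J x) (gamma_ext x) => w c.
rewrite !vecE !inertiaE; ring.
Qed.

End Form.

(** * The nonholonomic bracket of functions of (K, gamma) *)

Section BracketM.
Variables (R : realType) (mass r : R) (J : 'rV[R]_3).
Hypotheses (mass_gt0 : 0 < mass) (r_gt0 : 0 < r) (J_gt0 : forall i, 0 < J 0 i).
Implicit Types (x : phase R) (X Y Z : tangent R) (u w : 'cV[R]_3).
Notation V := ('cV[R]_3 * 'cV[R]_3)%type.
Implicit Types (z : V) (F G : V -> R).

Notation I := (inertia J).
Notation k := (mass * r ^+ 2).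
Notation OmT := (OmegaT mass r J).
Notation M := (Mset mass r J).
Notation pi := (pi_red mass r J).
Notation prj := (pi_ext mass r J).
Notation cv := (constrained mass r J).

Lemma gammaE x : SO3 (rot x) -> gamma x = gamma_ext x.
Proof. by move=> gS; rewrite /gamma SO3_invmx. Qed.

Lemma pi_redE x : SO3 (rot x) -> pi x = prj x.
Proof.
by move=> gS; rewrite /pi_red /Kb gammaE// -[invmx _ *m _]/(angvel J x) angvelK.
Qed.

Lemma dot_gamma_ext x : SO3 (rot x) -> dot (gamma_ext x) (gamma_ext x) = 1.
Proof.
move=> [g1 gd]; have gS : SO3 (rot x)^T by split; rewrite ?det_tr// trmxK; exact: mulmx1C.
by rewrite /gamma_ext SO3_dot// dotE /e3 !mxE /=; ring.
Qed.

Lemma pi_red_Rset x : M x -> Rset (pi x).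
Proof. by move=> [gS _]; rewrite /Rset /= gammaE// dot_gamma_ext. Qed.

Section Extension.
Variables (F G : V -> R) (x : phase R).
Hypotheses (xM : M x) (DG : differentiable G (pi x))
  (FG : \forall z \near pi x, Rset z -> F z = G z).

Let DGp : is_diff x (G \o prj) ('d G (pi x) \o dpi_ext mass r J x).
Proof.
have := differentiableP DG; rewrite pi_redE; last by case: xM.
by move=> HG; exact: is_diff_comp (is_diff_pi_ext mass r J x) HG.
Qed.

Let FGp : \forall y \near x, M y -> F (pi y) = G (prj y).
Proof.
have pc : {for x, continuous prj}.
  exact: differentiable_continuous (@ex_diff _ _ _ _ _ _ _ (is_diff_pi_ext mass r J x)).
have := FG; rewrite pi_redE; last by case: xM.
move=> /pc H.
have {}H : \forall y \near x, Rset (prj y) -> F (prj y) = G (prj y) by exact: H.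
near=> y => yM; have [gS _] := yM.
by have := pi_red_Rset yM; rewrite pi_redE//; near: y.
Unshelve. all: by end_near. Qed.

Let h := extension mass r J (F \o pi) x.

(** The function equal to [F \o pi] on Mset and to [G \o prj] elsewhere
    coincides with [G \o prj] near x, hence is differentiable at x. *)
Lemma extensionP : differentiable h x /\ forall y, M y -> h y = F (pi y).
Proof.
suff /getPex : exists h, [set h : phase R -> R | differentiable h x /\
    forall y, M y -> h y = (F \o pi) y] h by [].
exists (fun y => if `[<M y>] then F (pi y) else G (prj y)); split=> /=.
  apply: (@ex_diff _ _ _ _ _ _ _ (is_diff_near DGp _)).
  near=> y => /=; case: asboolP => // yM.
  by rewrite (near FGp y).
by move=> y yM; case: asboolP.
Unshelve. all: by end_near. Qed.

(** On tangent vectors to Mset the differential does not depend on the extension: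
    along a curve in Mset, h and [G \o prj] coincide. *)
Lemma dphase_extension u w : dphase h x (cv x u w) =
  dot (gradK G (pi x)) (Kdot mass r J x u w) + dot (gradgam G (pi x)) (cross (gamma_ext x) u).
Proof.
have [Dh hE] := extensionP.
have /(CdistP J_gt0 _ xM) : exists w', cv x u w = cv x (tw (cv x u w)) w' by exists w.
move=> [[c [c0 cM /is_diff_curve cD]] _].
have Hh := differentiableP Dh; have HG := DGp; rewrite -c0 in Hh HG.
have E1 := is_diff_comp cD Hh; have E2 := is_diff_comp cD HG.
have nE : \forall t \near (0 : R), (h \o c) t = ((G \o prj) \o c) t.
  have cc : {for 0, continuous c} by exact: differentiable_continuous (@ex_diff _ _ _ _ _ _ _ cD).
  have {}cc : \forall t \near 0, M (c t) -> F (pi (c t)) = G (prj (c t)).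
    by apply: (cc (fun y => M y -> F (pi y) = G (prj y))); rewrite c0; exact: FGp.
  near=> t.
  have cM' : M (c t) by near: t.
  rewrite /= hE//.
  by move: cM'; near: t.
have := near_eq_derive (1 : R) nE.
rewrite (is_diff_derive _ E1) (is_diff_derive _ E2) /= !scale1r c0 -/h -/(dphase h x _) => ->.
rewrite dpi_ext_constrained//.
by rewrite -deriveE// deriveE_grad.
Unshelve. all: by end_near. Qed.
End Extension.

End BracketM.

Section BracketFormula.
Variables (R : realType) (mass r : R) (J : 'rV[R]_3).
Hypotheses (mass_gt0 : 0 < mass) (r_gt0 : 0 < r) (J_gt0 : forall i, 0 < J 0 i).
Implicit Types (x : phase R) (X Y Z : tangent R) (u v w c : 'cV[R]_3).
Notation V := ('cV[R]_3 * 'cV[R]_3)%type.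
Implicit Types (z : V) (F G : V -> R).

Notation I := (inertia J).
Notation k := (mass * r ^+ 2).
Notation OmT := (OmegaT mass r J).
Notation M := (Mset mass r J).
Notation C := (Cdist mass r J).
Notation pi := (pi_red mass r J).
Notation cv := (constrained mass r J).
Notation Ai := (Ainv mass r J).

(** On the unit sphere, Y is the sum of the I_i c_i^2 / (I_i + k). *)
Lemma Yfun_gt0 c : dot c c = 1 -> 0 < Yfun mass r J c.
Proof.
move=> c1; have k0 := mr2_gt0 mass_gt0 r_gt0.
have -> : Yfun mass r J c = \sum_i J 0 i * (J 0 i + k)^-1 * c i 0 ^+ 2.
  rewrite /Yfun -/(Ai c) -[X in X - _]c1 /dot mulr_sumr -sumrB; apply: eq_bigr => i _.
  have : J 0 i + k != 0 by rewrite gt_eqF// addr_gt0.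
  by rewrite AinvE// => Jk0; field.
have p i : 0 < J 0 i * (J 0 i + k)^-1 by rewrite divr_gt0// addr_gt0.
have q i : 0 <= J 0 i * (J 0 i + k)^-1 * c i 0 ^+ 2 by rewrite mulr_ge0 ?sqr_ge0// ltW.
rewrite lt_neqAle sumr_ge0// andbT eq_sym psumr_eq0//; apply/negP => /allP H.
have c0 i : c i 0 = 0.
  have := H i (mem_index_enum _); rewrite /= mulf_eq0 gt_eqF//= sqrf_eq0.
  by move/eqP.
by have := c1; rewrite dotE !c0 !mul0r !addr0 => /eqP; rewrite eq_sym oner_eq0.
Qed.

(** The map from w to I w + k (w - (w . c) c) is A minus k times the projection to
    c, a perturbation of rank one: its inverse is given by the formula of
    Sherman and Morrison. *)
Definition contact_inv c u : 'cV[R]_3 :=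
  Ai u + (k * dot c (Ai u) / Yfun mass r J c) *: Ai c.

Lemma AinvK u : I *m Ai u + k *: Ai u = u.
Proof.
apply/matrixP => i j; rewrite ord1 mxE inertiaE [in X in _ + X]mxE AinvE//.
by rewrite mulrA -mulrA -mulrDl mulrA mulfV ?mul1r// gt_eqF// addr_gt0// mr2_gt0.
Qed.

Lemma contact_invK c u : Yfun mass r J c != 0 ->
  I *m contact_inv c u + k *: (contact_inv c u - dot (contact_inv c u) c *: c) = u.
Proof.
move=> Y0; rewrite -[RHS]AinvK /contact_inv.
have Yk : k * dot c (Ai c) = 1 - Yfun mass r J c by rewrite /Yfun -/(Ai c); ring.
set s := k * dot c (Ai u) / _.
have sE : k * dot (Ai u + s *: Ai c) c = s.
  rewrite dotC dotDr dotZr mulrDr (mulrCA k s) Yk mulrBr mulr1.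
  by rewrite [s * Yfun _ _ _ _]mulfVK// addrC subrK.
rewrite scalerBr scalerA sE mulmxDr scalerDr -scalemxAr.
rewrite -[X in _ - s *: X]AinvK.
by apply/matrixP => i j; rewrite !mxE; ring.
Qed.

(** Apply n . to K = A w - k (w . gamma) gamma. *)
Lemma spin_angvel x : SO3 (rot x) -> spin mass r J (pi x) = dot (angvel J x) (gamma_ext x).
Proof.
move=> gS; rewrite pi_redE// /spin /=.
have := Yfun_gt0 (dot_gamma_ext gS); set c := gamma_ext x; set w := angvel J x => Y0.
have Yn0 : Yfun mass r J c != 0 by rewrite gt_eqF.
apply: (mulIf Yn0); rewrite divfK//.
rewrite /Kb_ext -/c -(angvelK J_gt0 x) -/w.
have -> : I *m w + k *: (w - dot w c *: c) = (I *m w + k *: w) - (k * dot w c) *: c.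
  by rewrite scalerBr scalerA addrA.
rewrite /Yfun -/(Ai c) !dotE !colE !inertiaE !AinvE//.
by field; rewrite !gt_eqF// addr_gt0// mr2_gt0.
Qed.

Lemma OmegaTB x X Z Y : OmT x (X - Z) Y = OmT x X Y - OmT x Z Y.
Proof.
rewrite !OmegaTE// /canonical_form /=.
have dotBl n (a b d : 'cV[R]_n) : dot (a - b) d = dot a d - dot b d.
  by rewrite -!(dotC d) dotDr -scaleN1r dotZr mulN1r.
have -> : cross (tw X - tw Z) (tw Y) = cross (tw X) (tw Y) - cross (tw Z) (tw Y).
  by apply: col3P; rewrite !vecE; ring.
rewrite !(dotC (tw Y)) !(dotC (tv Y)) !(dotC (_ - k *: _)) !dotBl.
ring.
Qed.

(** The angular velocity u and the velocity of K are therefore independent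
    coordinates on the constraint distribution. *)
Lemma Kdot_surj x u t : SO3 (rot x) -> exists w, Kdot mass r J x u w = t.
Proof.
move=> gS; set c := gamma_ext x.
have Y0 : Yfun mass r J c != 0 by rewrite gt_eqF// Yfun_gt0// dot_gamma_ext.
set d := dot (angvel J x) (cross c u) *: c + dot (angvel J x) c *: cross c u.
exists (contact_inv c (t + k *: d)).
have := contact_invK (t + k *: d) Y0; move: (contact_inv _ _) => w wE.
rewrite /Kdot -/c -[RHS](addrK (k *: d)) -wE -[RHS]addrA; congr (_ + _).
rewrite -scalerBr; congr (_ *: _).
by rewrite /d; apply/matrixP => i j; rewrite !mxE; ring.
Qed.

(** The momentum shifted along the vertical: the coefficient of u1 x u2 in
    [OmegaT_constrained]. *)
Definition Lphase x : 'cV[R]_3 := Kb_ext mass r J x - (k * dot (angvel J x) (gamma_ext x)) *: gamma_ext x.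

Lemma LphaseE x : SO3 (rot x) -> Lphase x = Lvec mass r J (pi x).
Proof. by move=> gS; rewrite /Lvec spin_angvel// pi_redE. Qed.

(** The projection Z is characterized by Om (Z, W) = f W for W in the constraint
    distribution.  Testing with W of zero angular velocity yields the angular
    velocity of Z; testing with W that leaves K fixed yields the velocity that
    Z gives to K. *)
Lemma oproj_sharpP x a b (f : tangent R -> R) : M x -> linear_form f ->
  (forall u w, f (cv x u w) =
     dot a (Kdot mass r J x u w) + dot b (cross (gamma_ext x) u)) ->
  exists w, oproj (OmT x) (C x) (sharp (OmT x) f) = cv x a w /\
    Kdot mass r J x a w = cross (Lphase x) a + cross (gamma_ext x) b.
Proof.
move=> xM fl fE; have [gS _] := xM.
have SE := sharpP (OmegaTE mass r J_gt0 x) fl.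
set S := sharp (OmT x) f; set Z := oproj _ _ _.
have Ccv u w : C x (cv x u w) by apply/(CdistP J_gt0 _ xM); exists w.
have [ZC ZE] : C x Z /\ forall W, C x W -> OmT x (S - Z) W = 0.
  suff /getPex : exists Z, [set Z | C x Z /\ forall W, C x W -> OmT x (S - Z) W = 0] Z by [].
  have [w wE] := Kdot_surj a (cross (Lphase x) a + cross (gamma_ext x) b) gS.
  exists (cv x a w); split=> // W /(CdistP J_gt0 _ xM)[w' ->].
  rewrite OmegaTB SE fE OmegaT_constrained// wE -/(Lphase x).
  by move: (tw W) (Kdot _ _ _ _ _ _) (Lphase x) (gamma_ext x) => u t L c; rewrite !vecE; ring.
have /(CdistP J_gt0 _ xM)[w Zw] := ZC.
have {}ZE u w' : dot (tw Z) (Kdot mass r J x u w') - dot u (Kdot mass r J x (tw Z) w)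
    + dot (Lphase x) (cross (tw Z) u) = dot a (Kdot mass r J x u w') + dot b (cross (gamma_ext x) u).
  have := ZE _ (Ccv u w'); rewrite OmegaTB SE fE Zw OmegaT_constrained// => /eqP.
  by rewrite subr_eq0 => /eqP ->.
have cross0 v : cross v 0 = 0 by apply: col3P; rewrite !vecE; ring.
have dot0 v : dot v 0 = 0 by rewrite !vecE; ring.
have twZ : tw Z = a.
  apply: dot_inj => t; have [w' wE] := Kdot_surj 0 t gS.
  by have := ZE 0 w'; rewrite wE !cross0 [dot 0 _]dotC !dot0 subr0 !addr0.
exists w; split; first by rewrite -twZ.
apply: dot_inj => t; have [w' wE] := Kdot_surj t 0 gS.
have := ZE t w'; rewrite wE !dot0 twZ sub0r add0r => /eqP.
rewrite addrC subr_eq => /eqP E; rewrite dotC.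
have -> : dot t (Kdot mass r J x a w) = dot (Lphase x) (cross a t) - dot b (cross (gamma_ext x) t).
  by rewrite E; ring.
by move: (Lphase x) (gamma_ext x) => L c; rewrite !vecE; ring.
Qed.

Lemma bracketM_eq x F1 F2 G1 G2 : M x ->
  differentiable G1 (pi x) -> differentiable G2 (pi x) ->
  (\forall z \near pi x, Rset z -> F1 z = G1 z) ->
  (\forall z \near pi x, Rset z -> F2 z = G2 z) ->
  bracketM mass r J (F1 \o pi) (F2 \o pi) x =
  bivector (Lvec mass r J (pi x)) (pi x).2
    (gradK G1 (pi x)) (gradgam G1 (pi x)) (gradK G2 (pi x)) (gradgam G2 (pi x)).
Proof.
move=> xM D1 D2 E1 E2; have [gS _] := xM.
have [w1 [Z1 K1]] := oproj_sharpP xM (dphase_linear _ _) (dphase_extension J_gt0 xM D1 E1).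
have [w2 [Z2 K2]] := oproj_sharpP xM (dphase_linear _ _) (dphase_extension J_gt0 xM D2 E2).
transitivity (OmT x (cv x (gradK G1 (pi x)) w1) (cv x (gradK G2 (pi x)) w2)).
  by rewrite -Z1 -Z2.
rewrite OmegaT_constrained// K1 K2 -/(Lphase x) LphaseE//.
have -> : gamma_ext x = (pi x).2 by rewrite /= gammaE.
move: (Lvec _ _ _ _) (pi x).2 (gradK G1 _) (gradgam G1 _) (gradK G2 _) (gradgam G2 _)
  => L c a1 b1 a2 b2.
by rewrite /bivector !vecE; ring.
Qed.

End BracketFormula.

(** * The reduced bracket *)

Section Reduced.
Variables (R : realType) (mass r : R) (J : 'rV[R]_3).
Hypotheses (mass_gt0 : 0 < mass) (r_gt0 : 0 < r) (J_gt0 : forall i, 0 < J 0 i).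
Notation V := ('cV[R]_3 * 'cV[R]_3)%type.
Implicit Types (z : V) (F G : V -> R).

Notation M := (Mset mass r J).
Notation pi := (pi_red mass r J).

Lemma pi_red_surj z : Rset z -> exists2 x, M x & pi x = z.
Proof.
case: z => K c /= c1; have [g gS gE] := SO3_transitive c1.
have Y0 : Yfun mass r J c != 0 by rewrite gt_eqF// Yfun_gt0.
pose w := contact_inv mass r J c K.
pose x : phase R := (g, 0, inertia J *m w, mass *: (rollmx r *m (g *m w))).
have xw : angvel J x = w by rewrite /angvel /= mulKmx ?inertia_unit.
exists x; first by apply/MsetE; rewrite // xw.
by rewrite pi_redE// /pi_ext /Kb_ext xw /gamma_ext /= gE contact_invK.
Qed.

Definition extends_at F G z := differentiable G z /\ \forall w \near z, Rset w -> F w = G w.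

(** [bracketM] at a state depends only on the projection of the state, by
    [bracketM_eq]; this provides the function on the reduced space whose
    existence the definition of [bracketR] presupposes. *)
Lemma bracketR_eq F1 F2 G1 G2 z :
  (forall w, Rset w -> exists G, extends_at F1 G w) ->
  (forall w, Rset w -> exists G, extends_at F2 G w) ->
  extends_at F1 G1 z -> extends_at F2 G2 z -> Rset z ->
  bracketR mass r J F1 F2 z = bivector (Lvec mass r J z) z.2
    (gradK G1 z) (gradgam G1 z) (gradK G2 z) (gradgam G2 z).
Proof.
move=> X1 X2 [D1 E1] [D2 E2] Rz.
pose br := bracketM mass r J (F1 \o pi) (F2 \o pi).
have /getPex H : exists G, [set G : V -> R | forall x, M x -> G (pi x) = br x] G.
  exists (fun y => br (get [set x | M x /\ pi x = y])) => x xM.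
  have /getPex[] : exists y, [set y | M y /\ pi y = pi x] y by exists x.
  set y := get _ => yM yx.
  have [G1' [D1' E1']] := X1 _ (pi_red_Rset xM).
  have [G2' [D2' E2']] := X2 _ (pi_red_Rset xM).
  rewrite /br (bracketM_eq _ _ _ xM D1' D2' E1' E2')//.
  by rewrite -yx in D1' D2' E1' E2' *; rewrite (bracketM_eq _ _ _ yM D1' D2' E1' E2').
have [x xM xz] := pi_red_surj Rz; rewrite -xz in D1 D2 E1 E2 *.
transitivity (br x); first exact: H.
exact: bracketM_eq.
Qed.

(** The same function G must serve at all nearby points, as the inner bracket is
    differentiated. *)
Definition C2_extends_at F G z :=
  \forall w \near z, twice_diff G w /\ \forall y \near w, Rset y -> F y = G y.

Lemma smooth_on_C2 F z : smooth_on (@Rset R) F -> Rset z ->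
  exists G, C2_extends_at F G z.
Proof.
move=> FS /FS[U [G [Uo Uz GC FG]]]; exists G.
have [D1 D2] := GC 2%N.
have nU w : U w -> \forall y \near w, U y by move=> Uw; exact: open_nbhs_nbhs.
apply: filterS (nU _ Uz) => w Uw; split; last first.
  by apply: filterS (nU _ Uw) => y Uy Ry; rewrite FG.
split; first by apply: filterS (nU _ Uw) => y Uy; exact: D1.
by move=> v; have [D2v _] := D2 v; exact: D2v.
Qed.

Lemma C2_extends_at_ext F G z : C2_extends_at F G z -> extends_at F G z.
Proof. by move=> /nbhs_singleton[[/nbhs_singleton D _] E]. Qed.

Notation br := (bracketRmu mass r J).
Notation gbr := (gradbr mass r J).

Lemma bracketRmu_extends F1 F2 G1 G2 z :
  (forall w, Rset w -> exists G, extends_at F1 G w) ->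
  (forall w, Rset w -> exists G, extends_at F2 G w) ->
  C2_extends_at F1 G1 z -> C2_extends_at F2 G2 z -> Rset z ->
  extends_at (br F1 F2) (gbr G1 G2) z.
Proof.
move=> X1 X2 E1 E2 Rz; split.
  have [[T1 _] [T2 _]] := (nbhs_singleton E1, nbhs_singleton E2).
  have Y0 := Yfun_gt0 mass_gt0 r_gt0 J_gt0 Rz.
  exact: (@ex_diff _ _ _ _ _ _ _ (is_diff_gradbr mass_gt0 r_gt0 J_gt0 Y0 T1 T2)).
near=> w => Rw; rewrite /bracketRmu /gradbr.
have [[T1 H1] [T2 H2]] : (twice_diff G1 w /\ (\forall y \near w, Rset y -> F1 y = G1 y)) /\
  (twice_diff G2 w /\ (\forall y \near w, Rset y -> F2 y = G2 y)).
  by split; near: w.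
rewrite (@bracketR_eq F1 F2 G1 G2)//.
- by split=> //; have [/nbhs_singleton] := T1.
- by split=> //; have [/nbhs_singleton] := T2.
Unshelve. all: by end_near. Qed.

Lemma bracketRmu_eq F1 F2 G1 G2 z :
  (forall w, Rset w -> exists G, extends_at F1 G w) ->
  (forall w, Rset w -> exists G, extends_at F2 G w) ->
  extends_at F1 G1 z -> extends_at F2 G2 z -> Rset z ->
  br F1 F2 z = gbr G1 G2 z.
Proof. by move=> X1 X2 E1 E2 Rz; rewrite /bracketRmu (bracketR_eq X1 X2 E1 E2 Rz). Qed.

End Reduced.

Theorem theorem6p13 (R : realType) (mass r : R) (J : 'rV[R]_3)
    (mass_gt0 : 0 < mass) (r_gt0 : 0 < r) (J_gt0 : forall i, 0 < J 0 i)
    (F1 F2 F3 : 'cV[R]_3 * 'cV[R]_3 -> R)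
    (smF1 : smooth_on (@Rset R) F1) (smF2 : smooth_on (@Rset R) F2)
    (smF3 : smooth_on (@Rset R) F3) (z : 'cV[R]_3 * 'cV[R]_3) (Rz : Rset z) :
  let br := bracketRmu mass r J in
  br F1 (br F2 F3) z + br F2 (br F3 F1) z + br F3 (br F1 F2) z = 0.
Proof.
move=> br.
have X F : smooth_on (@Rset R) F -> forall w, Rset w -> exists G, extends_at F G w.
  by move=> FS w Rw; have [G E] := smooth_on_C2 FS Rw; exists G; exact: C2_extends_at_ext.
have XX F F' : smooth_on (@Rset R) F -> smooth_on (@Rset R) F' ->
    forall w, Rset w -> exists G, extends_at (br F F') G w.
  move=> FS FS' w Rw; have [G E] := smooth_on_C2 FS Rw; have [G' E'] := smooth_on_C2 FS' Rw.
  by exists (gradbr mass r J G G'); apply: bracketRmu_extends => //; exact: X.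
have [G1 E1] := smooth_on_C2 smF1 Rz.
have [G2 E2] := smooth_on_C2 smF2 Rz.
have [G3 E3] := smooth_on_C2 smF3 Rz.
have eq F F' F'' G G' G'' : smooth_on (@Rset R) F -> smooth_on (@Rset R) F' ->
    smooth_on (@Rset R) F'' -> C2_extends_at F G z -> C2_extends_at F' G' z ->
    C2_extends_at F'' G'' z ->
    br F (br F' F'') z = gradbr mass r J G (gradbr mass r J G' G'') z.
  move=> S S' S'' E E' E''; apply: bracketRmu_eq => //; [exact: X|exact: XX| |].
    exact: C2_extends_at_ext.
  by apply: bracketRmu_extends => //; exact: X.
rewrite (eq _ _ _ G1 G2 G3)// (eq _ _ _ G2 G3 G1)// (eq _ _ _ G3 G1 G2)//.
by apply: gradbr_jacobi => //; [exact: Yfun_gt0|case: (nbhs_singleton E1)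
  |case: (nbhs_singleton E2)|case: (nbhs_singleton E3)].
Qed.
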